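(* Suppose that, for some $\kappa\ge 1$ and $C>0$, the margin condition $$P(\gamma_j-\gamma_0)\ \ge\ \frac{d(f_j,f_0)^{2\kappa}}{C^{2\kappa}},\qquad j=1,\dots,p,$$ holds, where $d$ satisfies $d(f_j,f_0)\ge \sigma(\gamma_j-\gamma_0)$ for all $j$. Put $$A(\kappa):=\frac{1+(2\kappa-1)^{\frac1{2\kappa-1}}}{\kappa^{\frac1{2\kappa-1}}}.$$ (i) Assume that the envelope $\Gamma$ has power tails: for some $s>1$ and $M\in(0,\infty)$, $P(\{\Gamma>K\})\le (M/K)^s$ for all $K>0$. Then for all $m\in[2\kappa,\min(2s\kappa,1+\log p))$ and all $\tau>0$, $$\left\|\hat{\mathcal E}^{\frac1{2\kappa}}\right\|_m\le(\mathcal E_*\vee\tau)^{\frac1{2\kappa}}+A(\kappa)\,C^{\alpha}\Delta^{\alpha/2}+\xi(\kappa,s,m)\,M^{\frac sm\cdot\frac{\alpha}{\alpha+\beta}}\,\Delta^{\frac{\alpha\beta}{\alpha+\beta}}\,(\mathcal E_*\vee\tau)^{-\frac1{2\kappa}\cdot\frac{\alpha\beta}{\alpha+\beta}},$$ where $\alpha:=\frac1{2\kappa-1}$, $\beta:=\frac sm-\frac1{2\kappa}$ and $$\xi(\kappa,s,m):=A(\kappa)^{\frac{\beta}{\alpha+\beta}}\cdot 2^{\frac1{2\kappa}\cdot\frac{\alpha}{\alpha+\beta}}\cdot\left(\frac{m}{2s\kappa-m}\right)^{\frac{\alpha}{\alpha+\beta}\cdot\frac1m}\cdot\left(\left(\frac\beta\alpha\right)^{\frac{\alpha}{\alpha+\beta}}+\left(\frac\alpha\beta\right)^{\frac{\beta}{\alpha+\beta}}\right).$$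 (ii) Assume (in place of power tails) that the excess losses satisfy the exponential moment condition for some $K>0$: for all $m=2,3,\dots$ and all $j=1,\dots,p$, $P|\gamma_j^c-\gamma_*^c|^m\le\frac{m!}{2}(2K)^{m-2}d^2(f_j,f_* )$. Then for all $m\in[2\kappa,1+\log p)$ and all $\tau>0$, $$\left\|\hat{\mathcal E}^{\frac1{2\kappa}}\right\|_m\le(\mathcal E_*\vee\tau)^{\frac1{2\kappa}}+A(\kappa)\left(C\sqrt\Delta+\frac{K\Delta}{(\mathcal E_*\vee\tau)^{\frac1{2\kappa}}}\right)^{\frac1{2\kappa-1}}.$$ Moreover, in this case, if $\mathcal E_*>0$, then for all $t>0$, $$\mathbf P\left(\hat{\mathcal E}^{\frac1{2\kappa}}\ge\mathcal E_*^{\frac1{2\kappa}}+A(\kappa)\left(C\sqrt{\Delta+2t/n}+\frac{K(\Delta+2t/n)}{\mathcal E_*^{\frac1{2\kappa}}}\right)^{\frac1{2\kappa-1}}\right)\le e^{-t}.$$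
   Context: $Z_1,\dots,Z_n$ are independent (not necessarily identically distributed) random variables in a space $\mathcal Z$; $\mathbf P$ and $\mathbf E$ denote their distribution and expectation. For $\gamma:\mathcal Z\to\mathbb R$ put $P\gamma:=\frac1n\sum_{i=1}^n\mathbf E\gamma(Z_i)$ and $P_n\gamma:=\frac1n\sum_{i=1}^n\gamma(Z_i)$. $\gamma^c:=\gamma-\mathbf E\gamma$ denotes the centered function, i.e. $\gamma^c(Z_i)=\gamma(Z_i)-\mathbf E\gamma(Z_i)$ for each $i$; $P|\gamma^c|^m=\frac1n\sum_i\mathbf E|\gamma^c(Z_i)|^m$ and $\sigma^2(\gamma):=P|\gamma^c|^2$, $\sigma(\gamma)\ge0$. $\mathbf F$ is a subset of a metric space with metric $d$, and $\boldsymbol\Gamma=\{\gamma_f:f\in\mathbf F\}$ is a class of loss functions $\gamma_f:\mathcal Z\to\mathbb R$. Fixed (non-random) $f_1,\dots,f_p\in\mathbf F$ are given and $\gamma_j:=\gamma_{f_j}$. The empirical risk minimizer is $\hat\gamma:=\arg\min_{1\le j\le p}P_n\gamma_j$; the target is $\gamma_0=\gamma_{f_0}:=\arg\min_{\gamma\in\boldsymbol\Gamma}P\gamma$; the best approximation is $\gamma_*=\gamma_{f_*}:=\arg\min_{1\le j\le p}P\gamma_j$, with $f_*\in\{f_1,\dots,f_p\}$. Excess risks: $\hat{\mathcal E}:=P(\hat\gamma-\gamma_0)$ (a random variable: $P(\gamma_j-\gamma_0)$ evaluated at the selected index $j$) and $\mathcal E_*:=P(\gamma_*-\gamma_0)$.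 The envelope is $\Gamma:=\max_{1\le j\le p}|\gamma_j^c-\gamma_*^c|$, and $P(\{\Gamma>K\})=\frac1n\sum_i\mathbf P(\Gamma(Z_i)>K)$. Also $\Delta:=2\log(2p)/n$, $\|X\|_m:=(\mathbf E|X|^m)^{1/m}$, $a\vee b=\max(a,b)$. *)

(* Defs.v *)
From HB Require Import structures.
From mathcomp Require Export all_boot all_order all_algebra.
From mathcomp Require Export all_classical all_reals all_analysis.
Export Order.TTheory GRing.Theory Num.Theory.
Export numFieldNormedType.Exports.

Set Implicit Arguments.
Unset Strict Implicit.
Unset Printing Implicit Defensive.

Local Open Scope classical_set_scope.
Local Open Scope ring_scope.

Section independent_sample.
Context {dO dZ : measure_display} {Om : measurableType dO}
  {Zs : measurableType dZ} {R : realType}.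
Variables (Pr : probability Om R) (n : nat) (Z : 'I_n -> {RV Pr >-> Zs}).

Definition mutually_independent : Prop :=
  forall (J : {set 'I_n}) (B : 'I_n -> set Zs),
    (forall i, measurable (B i)) ->
    Pr (\bigcap_(i in [set` J]) (Z i @^-1` B i)) =
    (\prod_(i in J) Pr (Z i @^-1` B i))%E.

(* Functions of a sample point are allowed to depend on the index i of the
   observation, because the centered function (see centered below) does: the
   Z i need not have the same distribution. *)
Definition Pmean (g : 'I_n -> Zs -> R) : \bar R :=
  ((n%:R^-1)%:E * \sum_(i < n) 'E_Pr[g i \o Z i])%E.

(* Real-valued; only meaningful when every g \o Z i is integrable. *)
Definition risk (g : Zs -> R) : R := fine (Pmean (fun=> g)).

Definition empirical_risk (g : Zs -> R) (w : Om) : R :=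
  n%:R^-1 * \sum_(i < n) g (Z i w).

Definition centered (g : Zs -> R) (i : 'I_n) (z : Zs) : R :=
  g z - fine 'E_Pr[g \o Z i].

(* The absolute moments P|g|^m and sigma are extended reals: they may be +oo. *)
Definition abs_moment (m : nat) (g : 'I_n -> Zs -> R) : \bar R :=
  Pmean (fun i z => `|g i z| ^+ m).

Definition sigma (g : Zs -> R) : \bar R := sqrte (abs_moment 2 (centered g)).

Definition envelope (p : nat) (g : 'I_p -> Zs -> R) (gs : Zs -> R)
    (i : 'I_n) (z : Zs) : R :=
  \big[Num.max/0]_(j < p) `|centered (g j) i z - centered gs i z|.

(* P({h > K}) *)
Definition Ptail (h : 'I_n -> Zs -> R) (K : R) : \bar R :=
  ((n%:R^-1)%:E * \sum_(i < n) Pr [set w | (K < h i (Z i w))%R])%E.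

End independent_sample.

Section constants.
Context {R : realType}.
Implicit Types k s m : R.

Definition Delta (n p : nat) : R := 2 * ln (2 * p%:R) / n%:R.

Definition Aconst k : R :=
  (1 + (2 * k - 1) `^ (2 * k - 1)^-1) / k `^ (2 * k - 1)^-1.

Definition alphac k : R := (2 * k - 1)^-1.

Definition betac k s m : R := s / m - (2 * k)^-1.

Definition xi k s m : R :=
  let a := alphac k in
  let b := betac k s m in
  Aconst k `^ (b / (a + b)) *
  2 `^ ((2 * k)^-1 * (a / (a + b))) *
  (m / (2 * s * k - m)) `^ (a / (a + b) * m^-1) *
  ((b / a) `^ (a / (a + b)) + (a / b) `^ (b / (a + b))).

End constants.

(* Main.v *)
(* Write [x = Ehat `^ (2 kappa)^-1] and [y = (max Estar tau) `^ (2 kappa)^-1]. By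
   minimality of the empirical risk, and since the margin condition bounds the
   standard deviation of [gamma_j - gamma_star] by [C (x_j + y)], one has
   [x ^ (2 kappa) <= y ^ (2 kappa) + (x + y) z + T], where [z] is the maximum over
   the dictionary of the normalised deviations and [T = 0] in case (ii). This
   inequality forces [x <= y + A z ^ (2 kappa - 1)^-1 + T ^ (2 kappa)^-1]. The
   maximum [z] satisfies Bernstein's condition, so a Chernoff bound with a single
   exponent for all [j] controls both its tail and its [m]-th moment for
   [m <= 1 + ln p]. In case (i) the deviations are first clipped at a level [K];
   [T] is then the mean excess of the envelope over [K], the power tail gives
   its moments, and [K] is chosen to balance the two resulting terms. *)

Require Import Defs.
From mathcomp Require Import measurable_realfun ring lra.

Set Implicit Arguments.
Unset Strict Implicit.
Unset Printing Implicit Defensive.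

Local Open Scope classical_set_scope.
Local Open Scope ring_scope.

(** Dividing the deviation of [gamma_j - gamma_star] by [x_j + y] makes the dictionary homogeneous:
    the variance factor becomes the same [C] for every [j], and since [x_j + y >= y], one Bernstein
    scale [K / y] serves all higher moments. The role of [tau] is to keep [y] positive. The moment
    bound loses no numerical constant because of the 2 inside [Delta = 2 ln (2 p) / n]: the sum of
    the [p] exponentials has mean at most [p / (2 p) = 1/2], exactly the slack of [powR_le_expR].
    The observations need not be identically distributed and the hypotheses bound averages over [i],
    so moments and tails are kept summed over [i]. In case (i), clipping creates the missing higher
    moments but destroys the zero mean. The excess is therefore counted twice, once empirically and
    once in expectation, whence [2 ^ (1 / (2 kappa))] inside [xi]. The factor [m / (2 s kappa - m)]
    there is [r / (s - r)] for [r = m / (2 kappa)], the constant of a layer-cake integral. *)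

Section powR_inequalities.
Context {R : realType}.
Implicit Types a b c k h m r s t x y z L T : R.

(** Bernoulli's inequality. It is Young's inequality for the pair [t], [1] with exponents [r] and
    [r / (r - 1)], which is why [r = 1] is split off. *)
Lemma powR_ge_tangent1 r t : 1 <= r -> 0 <= t -> 1 + r * (t - 1) <= t `^ r.
Proof.
rewrite le_eqVlt => /predU1P[<- t0|r1 t0]; first by rewrite powRr1// mul1r subrKC.
have r0 : 0 < r by lra.
have q0 : 0 < r / (r - 1) by rewrite divr_gt0// subr_gt0.
have rq : r^-1 + (r / (r - 1))^-1 = 1 by field; lra.
have := conjugate_powR t0 ler01 r0 q0 rq.
rewrite mulr1 powR1 => H.
have {H} : r * t <= r * (t `^ r / r + 1 / (r / (r - 1))) by rewrite ler_pM2l.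
have -> : r * (t `^ r / r + 1 / (r / (r - 1))) = t `^ r + r - 1 by field; lra.
lra.
Qed.

Lemma powR_le_tangent1 r t : 0 < r -> r <= 1 -> 0 <= t -> t `^ r <= 1 + r * (t - 1).
Proof.
move=> r0 r1 t0.
have ri : 1 <= r^-1 by rewrite invf_ge1.
have := powR_ge_tangent1 ri (powR_ge0 t r).
rewrite -powRrM divff ?gt_eqF// powRr1// => H.
have : r * (1 + r^-1 * (t `^ r - 1)) <= r * t by rewrite ler_pM2l.
have -> : r * (1 + r^-1 * (t `^ r - 1)) = r + t `^ r - 1 by field; lra.
lra.
Qed.

(** Bernoulli at [a / c], rescaled by homogeneity: the supporting line of the convex power at [c],
    from which Jensen-type inequalities follow by integrating or averaging. *)
Lemma powR_ge_tangent r a c : 1 <= r -> 0 <= a -> 0 < c ->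
  c `^ r + r * c `^ (r - 1) * (a - c) <= a `^ r.
Proof.
move=> r1 a0 c0.
have t0 : 0 <= a / c by rewrite divr_ge0// ltW.
have := powR_ge_tangent1 r1 t0.
rewrite -(ler_pM2r (powR_gt0 r c0)) -powRM// ?(ltW c0)//.
rewrite divfK ?gt_eqF// -(@mulr_powRB1 _ c r) ?(ltW c0)//; last lra.
rewrite (_ : _ * (c * _) = c * c `^ (r - 1) + r * c `^ (r - 1) * (a - c))//.
by field; lra.
Qed.

Lemma powR_addr_ge r a b : 1 <= r -> 0 <= a -> 0 <= b ->
  a `^ r + b `^ r <= (a + b) `^ r.
Proof.
move=> r1 a0 b0.
have r0 : r != 0 by rewrite gt_eqF//; lra.
have [->|ba] := eqVneq b 0; first by rewrite powR0// !addr0.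
have [->|aa] := eqVneq a 0; first by rewrite powR0// !add0r.
have a1 : 0 < a by rewrite lt0r aa.
have b1 : 0 < b by rewrite lt0r ba.
have r0' : 0 < r by lra.
rewrite -(@mulr_powRB1 _ a r) // -(@mulr_powRB1 _ b r) // -(@mulr_powRB1 _ (a + b) r) //; last lra.
rewrite mulrDl lerD// ler_wpM2l// ge0_ler_powR// ?nnegrE; lra.
Qed.

Lemma powR_add_le r a b : 0 < r -> r <= 1 -> 0 <= a -> 0 <= b ->
  (a + b) `^ r <= a `^ r + b `^ r.
Proof.
move=> r0 r1 a0 b0.
have ri : 1 <= r^-1 by rewrite invf_ge1.
have := powR_addr_ge ri (powR_ge0 a r) (powR_ge0 b r).
rewrite -!powRrM divff ?gt_eqF// !powRr1// => H.
have := @ge0_ler_powR _ r (ltW r0) (a + b) ((a `^ r + b `^ r) `^ r^-1).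
rewrite !nnegrE powR_ge0 addr_ge0// => /(_ erefl erefl H).
by rewrite -powRrM mulVf ?gt_eqF// powRr1// addr_ge0 ?powR_ge0.
Qed.

Lemma Aconst_ge0 k : 1 <= k -> 0 <= Aconst k.
Proof. by move=> k1; rewrite /Aconst divr_ge0 ?powR_ge0// addr_ge0 ?powR_ge0. Qed.

(** Multiplied by [k ^ q] with [q = 1 / (2 k - 1) <= 1], this reads
    [(2 k) ^ q <= 1 + (2 k - 1) ^ q], an instance of subadditivity. The left-hand side is the
    constant that solving the basic inequality produces. *)
Lemma Aconst_ge k : 1 <= k -> 2 `^ (2 * k - 1)^-1 <= Aconst k.
Proof.
move=> k1; rewrite /Aconst.
have k0 : 0 < k by lra.
have q0 : 0 < 2 * k - 1 by lra.
rewrite ler_pdivlMr ?powR_gt0// -powRM//; last lra.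
have -> : 2 * k = 1 + (2 * k - 1) by lra.
have := @powR_add_le (2 * k - 1)^-1 1 (2 * k - 1).
rewrite powR1 addrAC subrr add0r; apply; rewrite ?invr_gt0//; last lra.
by rewrite invf_le1//; lra.
Qed.

(* The case [T = 0] is applied with [(y `^ (2 * k) + T) `^ (2 * k)^-1] in place of [y]. *)
Lemma root_le_of_powR_le k x y z T : 1 <= k -> 0 <= x -> 0 <= y -> 0 <= z -> 0 <= T ->
  x `^ (2 * k) <= y `^ (2 * k) + z * (x + y) + T ->
  x <= y + Aconst k * z `^ (2 * k - 1)^-1 + T `^ (2 * k)^-1.
Proof.
move=> k1 x0 y0 z0 T0 H.
have k0 : 0 < 2 * k by lra.
have q0 : 0 < 2 * k - 1 by lra.
have Ti : (y `^ (2 * k) + T) `^ (2 * k)^-1 <= y + T `^ (2 * k)^-1.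
  apply: le_trans (powR_add_le _ _ _ _) _ => //; rewrite ?invr_gt0 ?powR_ge0//.
    by rewrite invf_le1//; lra.
  by rewrite -powRrM divff ?gt_eqF// powRr1.
set y' := (y `^ (2 * k) + T) `^ (2 * k)^-1 in Ti.
have y'0 : 0 <= y' by apply: powR_ge0.
have yk : y' `^ (2 * k) = y `^ (2 * k) + T.
  by rewrite -powRrM mulVf ?gt_eqF// powRr1// addr_ge0 ?powR_ge0.
have yy : y <= y'.
  rewrite -[leLHS]powRr1// -(@divff _ (2 * k)) ?gt_eqF// powRrM.
  by rewrite ge0_ler_powR ?nnegrE ?invr_ge0 ?addr_ge0 ?powR_ge0 ?lerDl// (ltW k0).
rewrite addrAC; apply: (@le_trans _ _ (y' + Aconst k * z `^ (2 * k - 1)^-1)); last first.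
  by rewrite lerD2r.
have [xy|yx] := leP x y'.
  by rewrite (le_trans xy)// lerDl mulr_ge0 ?powR_ge0// Aconst_ge0.
have x1 : 0 < x by lra.
(* Here [y <= y' < x], so [x + y] may be replaced by [2 x]. *)
have {H} : x `^ (2 * k) <= y' `^ (2 * k) + 2 * z * x.
  have : 0 <= z * (x - y) by rewrite mulr_ge0//; lra.
  by rewrite yk; lra.
rewrite -(@mulr_powRB1 _ x (2 * k))// -(@mulr_powRB1 _ y' (2 * k))// => H.
have H1 : y' `^ (2 * k - 1) <= x `^ (2 * k - 1).
  by rewrite ge0_ler_powR ?nnegrE ?(ltW q0) ?(ltW yx) ?(ltW x1).
have H2 : (x - y') * x `^ (2 * k - 1) <= 2 * z * x.
  have : 0 <= y' * (x `^ (2 * k - 1) - y' `^ (2 * k - 1)) by rewrite mulr_ge0// subr_ge0.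
  lra.
(* After multiplication by [x], what is needed is [(x - y') ^ (2 k - 2) <= x ^ (2 k - 2)], with a
   nonnegative exponent because [k >= 1]. *)
have H3 : (x - y') `^ (2 * k - 1) <= 2 * z.
  rewrite -(ler_pM2r x1) (le_trans _ H2)//.
  have xy0 : 0 < x - y' by lra.
  rewrite -(@mulr_powRB1 _ x (2 * k - 1))// -(@mulr_powRB1 _ (x - y') (2 * k - 1)) ?(ltW xy0)//.
  rewrite -mulrA ler_pM2l// [leLHS]mulrC ler_pM2l// ge0_ler_powR ?nnegrE//; lra.
rewrite -lerBlDl.
have := @ge0_ler_powR _ (2 * k - 1)^-1 _ ((x - y') `^ (2 * k - 1)) (2 * z).
rewrite invr_ge0 !nnegrE powR_ge0 mulr_ge0// => /(_ (ltW q0) erefl erefl H3).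
rewrite -powRrM divff ?gt_eqF// powRr1; last lra.
move=> /le_trans; apply.
by rewrite powRM// ler_wpM2r ?powR_ge0// Aconst_ge.
Qed.

End powR_inequalities.

(** * A pointwise exponential bound on powers *)

Section powR_expR.
Context {R : realType}.
Implicit Types a b c k h m r s t x y z L T : R.
(* For [m - 1 <= L] this plays the role of Jensen's inequality for the function
   [u |-> ln (u + expR (m - 1)) `^ m], which is concave for [u >= 0]; the slack
   [2^-1] pays for the range [h < m - 1], where concavity fails. *)
Lemma powR_le_expR m L h : 2 <= m -> m - 1 <= L -> 0 <= h ->
  (h / L) `^ m <= 1 + m / L * (expR (h - L) - 2^-1).
Proof.
move=> m2 mL h0.
have L0 : 0 < L by lra.
have -> : h - L = L * (h / L - 1) by field; lra.
have : 0 <= h / L by rewrite divr_ge0// ltW.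
move: (h / L) => r r0.
have mL0 : 0 < m / L by rewrite divr_gt0//; lra.
(* [m <= 2 (m - 1) <= 2 L], from [2 <= m]. *)
have mL2 : m / L <= 2 by rewrite ler_pdivrMr//; lra.
have [r1|r1] := leP r 1.
  set v := expR _.
  have v0 : 0 < v by apply: expR_gt0.
  have v1 : v <= 1 by rewrite /v -[leRHS]expR0 ler_expR; rewrite mulr_ge0_le0 ?(ltW L0)//; lra.
  have H : r `^ m <= v `^ (m / L).
    rewrite /v expRM (_ : expR L `^ _ `^ _ = expR (r - 1) `^ m); last first.
      rewrite -!expRM; congr expR; field; lra.
    rewrite ge0_ler_powR ?nnegrE ?expR_ge0//; first lra.
    by have := expR_ge1Dx (r - 1); rewrite subrKC.
  (* With [q = m / L]: if [q <= 1], the tangent at [1] suffices. Otherwise [v ^ q <= v], and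
     [v <= 1 + q (v - 1/2)] amounts to [0 <= (1 - q / 2) + (q - 1) v]; this is where the slack [1/2]
     and [q <= 2] match. *)
  apply: (le_trans H); have [q1|q1] := leP (m / L) 1.
    by have := powR_le_tangent1 mL0 q1 (ltW v0); lra.
  have : v `^ (m / L) <= v by rewrite ge1r_powR ?v0//; lra.
  nra.
suff : r `^ m <= 1 + m / L * (expR (L * (r - 1)) - 1) by nra.
(* In the variable [t = ln r] the claim is [f 0 <= f (ln r)]. The function [f] increases on [t >= 0]
   because [t + L (expR t - 1) >= t + L t >= m t], by [m - 1 <= L]. *)
pose f t : R := m / L * expR (L * (expR t - 1)) - expR (m * t).
have r00 : 0 < r by lra.
have dr (t : R) : is_derive t 1 f (m * (expR t * expR (L * (expR t - 1)) - expR (m * t))).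
  have d1 : is_derive t 1 (fun t => expR (L * (expR t - 1))) (expR (L * (expR t - 1)) * (L * expR t)).
    apply: (@is_derive1_comp _ expR (fun t => L * (expR t - 1))).
    by apply: is_derive_eq; rewrite subr0.
  have d2 : is_derive t 1 (fun t => expR (m * t)) (expR (m * t) * m).
    apply: (@is_derive1_comp _ expR (fun t => m * t)).
    by apply: is_derive_eq; exact: mulr1.
  rewrite /f; apply: is_derive_eq; rewrite /GRing.scale/=.
  by field; lra.
have f0 : f 0 <= f (ln r).
  apply: (@ger0_derive1_ndecry _ f 0) => //.
  - move=> t /[!in_itv]/= /andP[t0 _]; rewrite derive1E derive_val mulr_ge0//; first lra.
    rewrite subr_ge0 -expRD ler_expR; have := expR_ge1Dx t.
    have : L * t <= L * (expR t - 1).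
      by rewrite ler_pM2l//; have := expR_ge1Dx t; lra.
    have : (m - 1) * t <= L * t by rewrite ler_pM2r.
    lra.
  - by apply: continuous_subspaceT => t; apply/differentiable_continuous/derivable1_diffP.
  - by rewrite ln_ge0// ltW.
move: f0; rewrite /f expR0 subrr mulr0 mulr0 expR0 lnK ?posrE//.
rewrite /powR gt_eqF//; lra.
Qed.
End powR_expR.

Lemma measurable_EFin d (T : measurableType d) (R : realType) (D : set T) (g : T -> R) :
  measurable_fun D g -> measurable_fun D (fun x => (g x)%:E).
Proof. by move=> mg; apply/measurable_EFinP. Qed.

Lemma measurable_fun_powR d (T : measurableType d) (R : realType) (D : set T) (g : T -> R) (r : R) :
  measurable_fun D g -> measurable_fun D (fun x => g x `^ r).
Proof. exact: (measurableT_comp (measurable_powR r)). Qed.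

(** * Product formula for expectations under independence *)

Section integral_weights.
Local Open Scope ereal_scope.
Context d d' (Om : measurableType d) (T : measurableType d') (R : realType).
Variables (mu : {measure set Om -> \bar R}) (X : Om -> T).
Hypothesis mX : measurable_fun [set: Om] X.

Import HBNNSimple.

Let integral_weight_lim (G : Om -> R) (phi : T -> R)
  (mphi : measurable_fun [set: T] (EFin \o phi)) :
  measurable_fun [set: Om] G -> (forall w, 0 <= G w)%R -> (forall x, 0 <= phi x)%R ->
  let h := nnsfun_approx measurableT mphi in
  \int[mu]_w (G w * phi (X w))%:E =
  limn (fun n => \sum_(r \in range (h n)) r%:E *
     \int[mu]_w (G w * \1_(h n @^-1` [set r]) (X w))%:E).
Proof.
move=> mG G0 phi0 h.
have mh n : measurable_fun [set: Om] (fun w => h n (X w)) by exact: measurableT_comp.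
have mI n r : measurable_fun [set: Om] (fun w => \1_(h n @^-1` [set r]) (X w) : R).
  exact: measurableT_comp.
transitivity (limn (fun n => \int[mu]_w (G w * h n (X w))%:E)).
  rewrite -monotone_convergence//=.
  - apply: eq_integral => w _; apply/esym/cvg_lim => //.
    have phi0' x : setT x -> 0 <= (EFin \o phi) x by rewrite /= lee_fin.
    have := @cvg_nnsfun_approx _ _ _ _ measurableT _ mphi phi0' (X w) I.
    by move=> /(cvgeZl (y := (G w)%:E) isT).
  - by move=> n; apply: measurable_EFin; exact: measurable_funM.
  - by move=> n w _; rewrite lee_fin mulr_ge0.
  - by move=> w _ a b ab; rewrite lee_fin ler_wpM2l//; exact/lefP/nd_nnsfun_approx.
congr (limn _); apply/funext => n.
under eq_integral.
  move=> w _; rewrite EFinM fimfunE -fsumEFin// ge0_mule_fsumr; last first.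
    by move=> r; rewrite EFinM nnfun_muleindic_ge0.
  over.
rewrite ge0_integral_fsum//=; last 2 first.
- move=> r; apply: emeasurable_funM; first exact/measurable_EFinP.
  by apply: measurable_EFin; apply: measurable_funM.
- by move=> r w _; rewrite mule_ge0//; [rewrite lee_fin|rewrite EFinM nnfun_muleindic_ge0].
apply: eq_fsbigr => r /[!inE] -[x _ <-].
rewrite -ge0_integralZl//=.
- by apply: eq_integral => w _; rewrite !EFinM muleCA.
- by apply: measurable_EFin; exact: measurable_funM.
- by move=> w _; rewrite lee_fin mulr_ge0.
by rewrite lee_fin.
Qed.

(** A substitute for conditioning on [X]: equality on indicators passes to simple functions and, by
    monotone convergence, to every nonnegative [phi]. It serves below with [G1] a product over the
    other coordinates and [G2] a constant. *)
Lemma eq_ge0_integral_weight (G1 G2 : Om -> R) :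
  measurable_fun [set: Om] G1 -> measurable_fun [set: Om] G2 ->
  (forall w, 0 <= G1 w)%R -> (forall w, 0 <= G2 w)%R ->
  (forall B, measurable B -> \int[mu]_w (G1 w * \1_B (X w))%:E =
                             \int[mu]_w (G2 w * \1_B (X w))%:E) ->
  forall phi : T -> R, measurable_fun [set: T] phi -> (forall x, 0 <= phi x)%R ->
  \int[mu]_w (G1 w * phi (X w))%:E = \int[mu]_w (G2 w * phi (X w))%:E.
Proof.
move=> m1 m2 G10 G20 H phi mphi phi0.
have mphi' : measurable_fun [set: T] (EFin \o phi) by exact/measurable_EFinP.
rewrite !(integral_weight_lim mphi')//; congr (limn _); apply/funext => n.
by apply: eq_fsbigr => r _; rewrite H.
Qed.

End integral_weights.

Section independent_product.
Local Open Scope ereal_scope.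
Context dO dZ (Om : measurableType dO) (Zs : measurableType dZ) (R : realType).
Variables (Pr : probability Om R) (n : nat) (Z : 'I_n -> {RV Pr >-> Zs}).

(** Independence is assumed for events, so indicators are replaced by general functions one
    coordinate at a time. Finiteness of the integrals lets their product over the other coordinates
    serve as a real weight. *)
Lemma ge0_integral_prod_independent (phi : 'I_n -> Zs -> R) :
  mutually_independent Z ->
  (forall i, measurable_fun [set: Zs] (phi i)) -> (forall i z, 0 <= phi i z)%R ->
  (forall i, \int[Pr]_w (phi i (Z i w))%:E < +oo) ->
  \int[Pr]_w (\prod_(i < n) phi i (Z i w))%:E = \prod_(i < n) \int[Pr]_w (phi i (Z i w))%:E.
Proof.
move=> indep mphi phi0 phioo.
(* Coordinates of index at least [k] are still restricted to indicators: [k = 0] is independence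
   itself, [k = n] is the claim. *)
suff: forall k (psi : 'I_n -> Zs -> R),
  (forall i, measurable_fun [set: Zs] (psi i)) -> (forall i z, 0 <= psi i z)%R ->
  (forall i, \int[Pr]_w (psi i (Z i w))%:E < +oo) ->
  (forall i : 'I_n, (k <= i)%N -> exists2 B, measurable B & psi i = \1_B) ->
  \int[Pr]_w (\prod_(i < n) psi i (Z i w))%:E = \prod_(i < n) \int[Pr]_w (psi i (Z i w))%:E.
  by move=> /(_ n phi); apply=> // i; rewrite leqNgt ltn_ord.
have mpsiZ (psi : 'I_n -> Zs -> R) i : (forall i, measurable_fun [set: Zs] (psi i)) ->
  measurable_fun [set: Om] (fun w => psi i (Z i w)) by move=> mpsi; exact: measurableT_comp.
elim=> [psi mpsi psi0 _ psiB|k ih psi mpsi psi0 psioo psiB].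
  have /choice[B BP] : forall i, exists B, measurable B /\ psi i = \1_B.
    by move=> i; have [B mB e] := psiB i isT; exists B.
  have mZB i : measurable (Z i @^-1` B i).
    by rewrite -[X in measurable X]setTI; apply: measurable_funP => //; case: (BP i).
  have PB i : \int[Pr]_w (psi i (Z i w))%:E = Pr (Z i @^-1` B i).
    rewrite -[in RHS](setIT (_ @^-1` _)) -integral_indic//.
    by apply: eq_integral => w _; rewrite (BP i).2.
  under [RHS]eq_bigr do rewrite PB.
  transitivity (\prod_(i in [set: 'I_n]%SET) Pr (Z i @^-1` B i)); last first.
    by apply: eq_bigl => i; rewrite inE.
  rewrite -(indep [set: 'I_n]%SET B (fun i => (BP i).1)).
  rewrite -[in RHS](setIT (\bigcap_(_ in _) _)) -integral_indic//; last first.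
    by apply: fin_bigcap_measurable => // i _.
  apply: eq_integral => w _; congr (_%:E); rewrite indicE.
  case: (boolP (w \in _)) => [/set_mem wB|/negP wB].
    by rewrite big1// => i _; rewrite (BP i).2 indicE mem_set//; apply: (wB i); rewrite /= inE.
  have [i iB] : exists i, ~ (B i (Z i w)).
    by apply/existsNP => H; apply: wB; apply/mem_set => i _; exact: H.
  by apply/eqP/prodf_eq0; exists i => //; rewrite (BP i).2 indicE memNset.
have [kn|nk] := ltnP k n; last first.
  by apply: ih => // i ki; have := ltn_ord i; rewrite ltnNge (leq_trans nk ki).
pose i0 := Ordinal kn.
pose G1 w := (\prod_(i < n | i != i0) psi i (Z i w))%R.
have cfin : \prod_(i < n | i != i0) \int[Pr]_w (psi i (Z i w))%:E \is a fin_num.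
  by elim/big_ind : _ => // [x y|i _]; [exact: fin_numM|];
    rewrite ge0_fin_numE//; apply: integral_ge0 => w _; rewrite lee_fin.
pose c := fine (\prod_(i < n | i != i0) \int[Pr]_w (psi i (Z i w))%:E).
have c0 : (0 <= c)%R.
  apply/fine_ge0/prode_ge0 => i _; apply: integral_ge0 => w _; rewrite lee_fin//.
under eq_integral do rewrite (bigD1 i0)//= mulrC.
rewrite [RHS](bigD1 i0)//= muleC -(fineK cfin) -/c.
rewrite -ge0_integralZl//; last 2 first.
- by apply: measurable_EFin; exact: (mpsiZ psi).
- by move=> w _; rewrite lee_fin.
under [RHS]eq_integral do rewrite -EFinM.
(* Coordinate [k] is freed: it remains to compare [G1] with the constant [c] on indicators of
   [Z i0], where the induction hypothesis applies to [psi']. *)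
apply: (@eq_ge0_integral_weight _ _ _ _ _ _ _ _ G1 (cst c)) => //.
- rewrite (_ : G1 = fun w => \prod_(i < n) if i != i0 then psi i (Z i w) else 1)%R; last first.
    by apply/funext => w; exact: big_mkcond.
  by apply: measurable_prod => i _; case: (i != i0) => //; exact: (mpsiZ psi).
- by move=> w; exact: prodr_ge0.
move=> A mA.
pose psi' i := if i == i0 then \1_A else psi i.
have psi'i0 : psi' i0 = \1_A by rewrite /psi' eqxx.
have psi'N i : i != i0 -> psi' i = psi i by rewrite /psi' => /negPf ->.
have mAZ : measurable_fun [set: Om] (fun w => \1_A (Z i0 w) : R) by exact: measurableT_comp.
have : \int[Pr]_w (\prod_(i < n) psi' i (Z i w))%:E =
       \prod_(i < n) \int[Pr]_w (psi' i (Z i w))%:E.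
  apply: ih => [i|i z|i|i ki]; rewrite /psi'; case: eqVneq => // ii0.
  - rewrite ii0; apply: (@le_lt_trans _ _ (\int[Pr]_w cst 1 w)).
      apply: ge0_le_integral => //.
      + exact: measurable_EFin.
      + by move=> w _; rewrite lee_fin indicE lern1; case: (_ \in _).
    by rewrite integral_cst// mul1e -ge0_fin_numE// fin_num_measure.
  - by exists A.
  - apply: psiB; rewrite ltn_neqAle ki andbT; apply: contra_neq ii0 => ki0; exact/val_inj.
rewrite [in RHS](bigD1 i0)//= psi'i0 muleC => psi'E.
transitivity (\int[Pr]_w (\prod_(i < n) psi' i (Z i w))%:E).
  apply: eq_integral => w _; rewrite [in RHS](bigD1 i0)//= mulrC psi'i0.
  by congr ((_ * _)%:E); apply: eq_bigr => i ii0; rewrite psi'N.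
rewrite psi'E.
have -> : \prod_(i < n | i != i0) \int[Pr]_w (psi' i (Z i w))%:E = c%:E.
  by rewrite fineK//; apply: eq_bigr => i ii0; rewrite psi'N.
rewrite -ge0_integralZl//.
by apply: measurable_EFin.
Qed.

End independent_product.

(** * Bernstein's inequality for sums of independent variables *)

Lemma sum_geometric_le (R : realType) (x : R) N : 0 <= x -> x < 1 ->
  \sum_(j < N) x ^+ j <= (1 - x)^-1.
Proof.
move=> x0 x1; rewrite -[leRHS]mul1r ler_pdivlMr ?subr_gt0// mulrC.
have := subrX1 x N; rewrite -opprB => /(congr1 -%R); rewrite -mulNr !opprB => <-.
by rewrite gerBl exprn_ge0.
Qed.

(** Absolute values are taken because Bernstein's condition controls absolute moments; the
    extended-real series can then be integrated term by term. *)
Lemma expR_sub1_le_series (R : realType) (x : R) :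
  ((expR x - 1 - x)%:E <= \sum_(j <oo) (`|x| ^+ j.+2 / j.+2`!%:R)%:E)%E.
Proof.
set S := (X in (_ <= X)%E).
have S0 : (0 <= S)%E by apply: nneseries_ge0 => j _ _; rewrite lee_fin divr_ge0.
have [Soo|] := boolP (S == +oo)%E; first by rewrite (eqP Soo) leey.
move=> Soo; have Sfin : S \is a fin_num by rewrite ge0_fin_numE// ltey.
rewrite -(fineK Sfin) lee_fin lerBlDr lerBlDr.
rewrite /expR; apply: limr_le; first exact: is_cvg_series_exp_coeff.
exists 2%N => // -[//|[//|N]] _.
rewrite /series/= big_nat_recl// big_nat_recl// /exp_coeff/= expr0 fact0 divr1.
rewrite expr1 factS fact0 muln1 divr1.
set s := \sum_(_ <= _ < _) _; suff: s <= fine S by lra.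
rewrite {}/s.
have := @nneseries_lim_ge _ (fun j => (`|x| ^+ j.+2 / j.+2`!%:R)%:E) xpredT 0 N.
rewrite -/S -lee_fin fineK// => SN; apply: le_trans (SN _); last first.
  by move=> j _ _; rewrite lee_fin divr_ge0.
rewrite sumEFin lee_fin; apply: ler_sum => j _.
by rewrite (le_trans (ler_norm _))// normrM normfV normrX (ger0_norm (ler0n _ _)).
Qed.

Section bernstein1.
Local Open Scope ereal_scope.
Context d (T : measurableType d) (R : realType) (P : probability T R).

Lemma integral_cst_probability (r : \bar R) : \int[P]_w r = r.
Proof.
by rewrite integral_cst// -[RHS]mule1; congr (_ * _); exact: probability_setT.
Qed.

(** With [mu] the mean of [X], the left-hand side is [expR (- lam mu) (1 + lam mu + q)], and
    [1 + u <= expR u] absorbs [lam mu]. Thus an integral of the uncentered [X] controls the centered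
    exponential moment, which is what clipped functions will require. *)
Lemma mgf_centered_le (X : T -> R) (lam : R) : measurable_fun [set: T] X ->
  P.-integrable [set: T] (EFin \o X) ->
  let q := \int[P]_w (expR (lam * X w) - 1 - lam * X w)%:E in
  q < +oo ->
  \int[P]_w (expR (lam * (X w - fine (\int[P]_w (X w)%:E))))%:E <= (expR (fine q))%:E.
Proof.
move=> mX iX q qoo; set mu := fine _.
have mE : measurable_fun [set: T] (fun w => expR (lam * X w) - 1 - lam * X w)%R.
  apply: measurable_funB; last exact: measurable_funM.
  by apply: measurable_funB => //; apply: measurableT_comp => //; exact: measurable_funM.
have E0 w : (0 <= expR (lam * X w) - 1 - lam * X w)%R.
  by have := expR_ge1Dx (lam * X w); lra.
have q0 : 0 <= q by apply: integral_ge0 => w _; rewrite lee_fin.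
have qfin : q \is a fin_num by rewrite ge0_fin_numE.
have iE : P.-integrable [set: T] (EFin \o (fun w => expR (lam * X w) - 1 - lam * X w)%R).
  apply/integrableP; split; first exact: measurable_EFin.
  by rewrite (le_lt_trans _ qoo)// /q; under eq_integral do rewrite /= ger0_norm//.
have Xfin : \int[P]_w (X w)%:E \is a fin_num by exact: integrable_fin_num.
have ilX : P.-integrable [set: T] (fun w => (lam%:E * (X w)%:E)) by exact: integrableZl.
have i1 : P.-integrable [set: T] (cst 1%:E) by exact: finite_measure_integrable_cst.
have expE : \int[P]_w (expR (lam * X w))%:E = (1 + lam * mu + fine q)%:E.
  transitivity (\int[P]_w ((1%:E + lam%:E * (X w)%:E) +
                           (expR (lam * X w) - 1 - lam * X w)%:E)).
    by apply: eq_integral => w _; rewrite -EFinM -!EFinD; congr (_%:E); ring.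
  rewrite integralD//; last exact: integrableD.
  rewrite integralD// integral_cst_probability integralZl// -/q.
  by rewrite -(fineK qfin) -(fineK Xfin) -/mu -EFinM -!EFinD.
rewrite (_ : \int[P]_w _ = \int[P]_w ((expR (- (lam * mu)))%:E * (expR (lam * X w))%:E)); last first.
  by apply: eq_integral => w _; rewrite -EFinM -expRD; congr ((expR _)%:E); ring.
rewrite ge0_integralZl//=.
- rewrite expE -EFinM lee_fin expRN ler_pdivrMl ?expR_gt0// -expRD.
  by apply: le_trans (expR_ge1Dx _); rewrite addrA.
- by apply: measurable_EFin; apply: measurableT_comp => //; exact: measurable_funM.
Qed.

Lemma integral_expR_sub1_le (X : T -> R) (lam : R) : measurable_fun [set: T] X -> (0 <= lam)%R ->
  \int[P]_w (expR (lam * X w) - 1 - lam * X w)%:E <=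
  \sum_(j <oo) ((lam ^+ j.+2 / j.+2`!%:R)%:E * \int[P]_w (`|X w| ^+ j.+2)%:E).
Proof.
move=> mX lam0.
have mXj j : measurable_fun [set: T] (fun w => (`|X w| ^+ j.+2)%R).
  by apply: measurable_funX; exact: measurableT_comp.
under [leRHS]eq_eseriesr => j _.
  rewrite -ge0_integralZl//; last 2 first.
  - exact: measurable_EFin.
  - by rewrite lee_fin divr_ge0 ?exprn_ge0.
  over.
rewrite -integral_nneseries//; last 2 first.
- by move=> j; apply: measurable_funeM; exact: measurable_EFin.
- by move=> j w _; rewrite -EFinM lee_fin mulr_ge0 ?divr_ge0 ?exprn_ge0.
apply: ge0_le_integral => //.
- by move=> w _; rewrite lee_fin; have := expR_ge1Dx (lam * X w); lra.
- apply: measurable_EFin; apply: measurable_funB; last exact: measurable_funM.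
  by apply: measurable_funB => //; apply: measurableT_comp => //; exact: measurable_funM.
- apply: (@ge0_emeasurable_sum _ _ _ _ _ xpredT) => [j w _ _|j _].
    by rewrite -EFinM lee_fin mulr_ge0 ?divr_ge0 ?exprn_ge0.
  by apply: measurable_funeM; exact: measurable_EFin.
move=> w _; apply: le_trans (expR_sub1_le_series _) _.
apply: lee_nneseries => [j _ _|j _]; first by rewrite lee_fin divr_ge0 ?exprn_ge0.
by rewrite -EFinM lee_fin normrM (ger0_norm lam0) exprMn mulrAC.
Qed.

End bernstein1.

Section bernstein_sum.
Context dO dZ (Om : measurableType dO) (Zs : measurableType dZ) (R : realType).
Variables (Pr : probability Om R) (n : nat) (Z : 'I_n -> {RV Pr >-> Zs}).
Hypothesis indepZ : mutually_independent Z.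
Implicit Types (g : 'I_n -> Zs -> R) (K W D lam : R).

Definition centered_sum g (w : Om) : R :=
  \sum_(i < n) (g i (Z i w) - fine (\int[Pr]_v (g i (Z i v))%:E)%E).

(* The functions [g i] need not be centered: only their absolute moments enter. *)
Definition bernstein_moments K W g : Prop :=
  [/\ forall i, measurable_fun [set: Zs] (g i),
      forall i, Pr.-integrable [set: Om] (fun w => (g i (Z i w))%:E) &
      forall k, (\sum_(i < n) \int[Pr]_w (`|g i (Z i w)| ^+ k.+2)%:E <=
        (n%:R * (k.+2`!%:R / 2 * (2 * K) ^+ k * W ^+ 2))%:E)%E].

Lemma measurable_centered_sum g : (forall i, measurable_fun [set: Zs] (g i)) ->
  measurable_fun [set: Om] (centered_sum g).
Proof.
move=> mg; apply: measurable_sum => i; apply: measurable_funB => //.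
exact: measurableT_comp.
Qed.

(** The factorials of the moment condition cancel those of the exponential series and leave a
    geometric series of ratio [lam * (2 * K)]. A bound on the sum of the [q i] is enough, since the
    product over [i] adds the exponents. *)
Lemma mgf_centered_sum_le g K W lam : 0 <= K -> 0 <= lam -> lam * (2 * K) < 1 ->
  bernstein_moments K W g ->
  (\int[Pr]_w (expR (lam * centered_sum g w))%:E <=
   (expR (n%:R * lam ^+ 2 * W ^+ 2 / (2 * (1 - lam * (2 * K)))))%:E)%E.
Proof.
move=> K0 lam0 lamK [mg ig momg].
pose q i := (\int[Pr]_w (expR (lam * g i (Z i w)) - 1 - lam * g i (Z i w))%:E)%E.
have mgZ i : measurable_fun [set: Om] (fun w => g i (Z i w)) by exact: measurableT_comp.
have q0 i : (0 <= q i)%E.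
  by apply: integral_ge0 => w _; rewrite lee_fin; have := expR_ge1Dx (lam * g i (Z i w)); lra.
have sumq : (\sum_(i < n) q i <=
    (n%:R * lam ^+ 2 * W ^+ 2 / (2 * (1 - lam * (2 * K))))%:E)%E.
  apply: (@le_trans _ _ (\sum_(i < n) \sum_(j <oo) ((lam ^+ j.+2 / j.+2`!%:R)%:E *
      \int[Pr]_w (`|g i (Z i w)| ^+ j.+2)%:E))%E).
    by apply: lee_sum => i _; exact: integral_expR_sub1_le.
  rewrite -nneseries_sum; last first.
    move=> i j _; rewrite mule_ge0 ?lee_fin ?divr_ge0 ?exprn_ge0//.
    by apply: integral_ge0 => w _; rewrite lee_fin.
  apply: lime_le.
    apply: is_cvg_nneseries => j _ _; apply: sume_ge0 => i _.
    rewrite mule_ge0 ?lee_fin ?divr_ge0 ?exprn_ge0//.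
    by apply: integral_ge0 => w _; rewrite lee_fin.
  apply: nearW => N.
  apply: (@le_trans _ _ (\sum_(0 <= j < N) (n%:R * lam ^+ 2 * W ^+ 2 / 2 * (lam * (2 * K)) ^+ j)%:E)%E).
    apply: lee_sum => j _; rewrite -ge0_sume_distrr; last first.
      by move=> i _; apply: integral_ge0 => w _; rewrite lee_fin.
    apply: (le_trans (lee_wpmul2l _ (momg j))); rewrite ?lee_fin ?divr_ge0 ?exprn_ge0//.
    have j0 : (j.+2`!%:R : R) != 0 by rewrite pnatr_eq0 -lt0n fact_gt0.
    rewrite le_eqVlt; apply/orP; left; apply/eqP.
    by rewrite !exprMn !exprS; field.
  rewrite sumEFin lee_fin -mulr_sumr.
  rewrite [leRHS](_ : _ = n%:R * lam ^+ 2 * W ^+ 2 / 2 * (1 - lam * (2 * K))^-1); last first.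
    by rewrite invfM !mulrA.
  rewrite ler_wpM2l//; first by rewrite divr_ge0// mulr_ge0 ?sqr_ge0// mulr_ge0 ?sqr_ge0.
  by rewrite big_mkord; apply: sum_geometric_le => //; rewrite !mulr_ge0.
have qoo i : (q i < +oo)%E.
  apply: (@le_lt_trans _ _ (\sum_(i < n) q i)%E); last exact: (le_lt_trans sumq (ltry _)).
  by rewrite (bigD1 i)//= leeDl// sume_ge0.
have mgfi i := mgf_centered_le (mgZ i) (ig i) (qoo i).
pose phi i z := expR (lam * (g i z - fine (\int[Pr]_v (g i (Z i v))%:E)%E)).
rewrite (_ : \int[Pr]_w _ = \int[Pr]_w (\prod_(i < n) phi i (Z i w))%:E)%E; last first.
  by apply: eq_integral => w _; rewrite /phi -expR_sum mulr_sumr.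
rewrite ge0_integral_prod_independent//.
- apply: (@le_trans _ _ (\prod_(i < n) (expR (fine (q i)))%:E)%E).
    suff : forall s : seq 'I_n, (0 <= \prod_(i <- s) \int[Pr]_w (phi i (Z i w))%:E <=
        \prod_(i <- s) (expR (fine (q i)))%:E)%E by move=> /(_ (index_enum _))/andP[].
    elim=> [|i s /andP[s0 se]]; first by rewrite !big_nil lee01 lexx.
    have phii0 : (0 <= \int[Pr]_w (phi i (Z i w))%:E)%E.
      by apply: integral_ge0 => w _; rewrite lee_fin expR_ge0.
    rewrite !big_cons; apply/andP; split; first exact: mule_ge0.
    by apply: lee_pmul => //; exact: mgfi.
  rewrite prodEFin -expR_sum lee_fin ler_expR -lee_fin -sumEFin.
  by under eq_bigr do rewrite fineK ?ge0_fin_numE//.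
- by move=> i; apply: measurableT_comp => //; apply: measurable_funM => //; exact: measurable_funB.
- by move=> i z; exact: expR_ge0.
- by move=> i; apply: le_lt_trans (mgfi i) (ltry _).
Qed.

(** Bernstein's quantile with [D = 2 u / n]: it equals [W sqrt (2 u / n) + 2 K u / n], and
    corresponds to the probability [expR (- u)]. *)
Definition bernstein_bound K W D : R := W * Num.sqrt D + K * D.

(* The minimiser over [lam] of the exponent in [mgf_centered_sum_le] minus
   [lam * n%:R * bernstein_bound K W D]. *)
Definition chernoff_rate K W D : R := Num.sqrt D / (2 * K * Num.sqrt D + W).

(** At this rate [1 - lam * (2 * K)] equals [W / (2 * K * Num.sqrt D + W)], and the total exponent
    collapses to exactly [- (n D / 2)]. *)
Lemma chernoff_centered_sum g K W D : 0 <= K -> 0 < W -> 0 < D ->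
  bernstein_moments K W g ->
  (\int[Pr]_w (expR (chernoff_rate K W D * (centered_sum g w - n%:R * bernstein_bound K W D)))%:E <=
   (expR (- (n%:R * D / 2)))%:E)%E.
Proof.
move=> K0 W0 D0 bg; set H := bernstein_bound K W D; set lam := chernoff_rate K W D.
have r0 : 0 < Num.sqrt D by rewrite sqrtr_gt0.
have rD : D = Num.sqrt D ^+ 2 by rewrite sqr_sqrtr// ltW.
have d0 : 0 < 2 * K * Num.sqrt D + W.
  by rewrite ltr_wpDl// !mulr_ge0// ltW.
have lam0 : 0 <= lam by rewrite divr_ge0// ltW.
have lamK : lam * (2 * K) < 1.
  rewrite /lam /chernoff_rate mulrAC ltr_pdivrMr//; lra.
rewrite (_ : \int[Pr]_w _ = \int[Pr]_w ((expR (- (lam * (n%:R * H))))%:E *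
   (expR (lam * centered_sum g w))%:E))%E; last first.
  by apply: eq_integral => w _; rewrite -EFinM -expRD; congr ((expR _)%:E); ring.
have mg : measurable_fun [set: Om] (fun w => (expR (lam * centered_sum g w))%:E).
  apply: measurable_EFin; apply: measurableT_comp => //; apply: measurable_funM => //.
  by apply: measurable_centered_sum; case: bg.
rewrite ge0_integralZl//= ?lee_fin ?expR_ge0//.
apply: le_trans (lee_wpmul2l _ (mgf_centered_sum_le K0 lam0 lamK bg)) _.
  by rewrite lee_fin expR_ge0.
rewrite -EFinM -expRD lee_fin ler_expR le_eqVlt; apply/orP; left; apply/eqP.
rewrite /H /lam /chernoff_rate /bernstein_bound rD sqrtr_sqr ger0_norm ?(ltW r0)//.
set r := Num.sqrt D in r0 d0 *.
by field; rewrite gt_eqF//= (_ : _ - _ = W); [rewrite gt_eqF|ring].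
Qed.

End bernstein_sum.

(** * Moment comparisons and measurability *)

Section Lnorm_bounds.
Context d (T : measurableType d) (R : realType) (P : probability T R).
Implicit Types (X Y : T -> R) (b m r : R).

Lemma Lnorm_le X b m : 0 < m -> 0 <= b -> (forall w, 0 <= X w) ->
  (\int[P]_w (X w `^ m)%:E <= (b `^ m)%:E)%E -> ('N[P]_m%:E[EFin \o X] <= b%:E)%E.
Proof.
move=> m0 b0 X0 H; rewrite unlock.
under eq_integral do rewrite /= ger0_norm ?X0//.
have -> : b%:E = ((b `^ m)%:E `^ m^-1)%E.
  by rewrite poweR_EFin -powRrM divff ?gt_eqF// powRr1.
have I0 : (0 <= \int[P]_w (X w `^ m)%:E)%E.
  by apply: integral_ge0 => w _; rewrite lee_fin powR_ge0.
have Ifin : (\int[P]_w (X w `^ m)%:E)%E \is a fin_num.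
  by rewrite ge0_fin_numE// (le_lt_trans H)// ltry.
rewrite -(fineK Ifin) in H I0 *.
by rewrite !poweR_EFin lee_fin ge0_ler_powR ?nnegrE ?powR_ge0 ?invr_ge0 ?(ltW m0).
Qed.

(** Jensen for the concave power [r] of the [m]-th power of [X]. The tangent is taken at [b ^ m]
    rather than at the actual moment, so an upper bound on the moment suffices. *)
Lemma integral_powR_powR_le X b m r : 0 < m -> 0 < b -> 0 < r -> r <= 1 ->
  measurable_fun [set: T] X -> (forall w, 0 <= X w) ->
  (\int[P]_w (X w `^ m)%:E <= (b `^ m)%:E)%E ->
  (\int[P]_w ((X w `^ r) `^ m)%R%:E <= ((b `^ r) `^ m)%R%:E)%E.
Proof.
move=> m0 b0 r0 r1 mX X0 H.
have mXm : measurable_fun [set: T] (fun w => (X w `^ m)%R%:E).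
  by apply: measurable_EFin; exact: measurable_fun_powR.
have mXrm : measurable_fun [set: T] (fun w => (X w `^ r) `^ m : R)%R.
  by do 2 apply: measurable_fun_powR.
have bm : 0 < b `^ m by exact: powR_gt0.
have c0 : 0 <= (b `^ r) `^ m by apply: powR_ge0.
apply: (@le_trans _ _ (\int[P]_w (((b `^ r) `^ m * (1 - r))%:E +
     ((b `^ r) `^ m * r / b `^ m)%:E * (X w `^ m)%:E)))%E.
  apply: ge0_le_integral.
  - exact: measurableT.
  - by move=> w _; rewrite lee_fin powR_ge0.
  - exact: measurable_EFin.
  - by apply: emeasurable_funD => //; exact: measurable_funeM.
  move=> w _; rewrite -EFinM -EFinD lee_fin -mulrA -mulrA -mulrDr.
  rewrite (powRAC (X w)) (powRAC b).
  have -> : (X w `^ m) `^ r = (b `^ m) `^ r * (X w `^ m / b `^ m) `^ r.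
    by rewrite -powRM ?divr_ge0 ?powR_ge0// mulrC divfK// gt_eqF.
  rewrite ler_wpM2l ?powR_ge0//.
  have := powR_le_tangent1 r0 r1 (divr_ge0 (powR_ge0 (X w) m) (ltW bm)).
  lra.
rewrite ge0_integralD//; last 3 first.
- by move=> w _; rewrite lee_fin mulr_ge0// subr_ge0.
- by move=> w _; rewrite -EFinM lee_fin mulr_ge0 ?powR_ge0// divr_ge0 ?powR_ge0// mulr_ge0// ltW.
- exact: measurable_funeM.
rewrite integral_cst_probability ge0_integralZl//; last 2 first.
- by move=> w _; rewrite lee_fin powR_ge0.
- by rewrite lee_fin divr_ge0 ?powR_ge0// mulr_ge0// ltW.
apply: (@le_trans _ _ (((b `^ r) `^ m * (1 - r))%:E +
     ((b `^ r) `^ m * r / b `^ m)%:E * (b `^ m)%:E))%E.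
  by rewrite leeD2l// lee_wpmul2l// lee_fin divr_ge0 ?powR_ge0// mulr_ge0// ltW.
rewrite -EFinM -EFinD lee_fin divfK ?gt_eqF//; lra.
Qed.

End Lnorm_bounds.

Lemma measurable_bigmaxr d (T : measurableType d) (R : realType) (I : Type)
    (s : seq I) (h : I -> T -> R) :
  (forall i, measurable_fun [set: T] (h i)) ->
  measurable_fun [set: T] (fun x => \big[Num.max/0]_(i <- s) h i x).
Proof.
move=> mh; elim: s => [|i s ih].
  by under eq_fun do rewrite big_nil; exact: measurable_cst.
by under eq_fun do rewrite big_cons; exact: measurable_maxr.
Qed.

Lemma measurable_set_ler d (T : measurableType d) (R : realType) (f h : T -> R) :
  measurable_fun [set: T] f -> measurable_fun [set: T] h ->
  measurable [set x | f x <= h x].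
Proof.
move=> mf mh; rewrite -[X in measurable X]setTI.
exact: (measurable_fun_ler mf mh measurableT (_ : measurable [set true])).
Qed.

(** * Tail and moments of the maximum over the dictionary *)

Section max_deviation.
Context dO dZ (Om : measurableType dO) (Zs : measurableType dZ) (R : realType).
Variables (Pr : probability Om R) (n : nat) (Z : 'I_n -> {RV Pr >-> Zs}).
Hypotheses (n_gt0 : (0 < n)%N) (indepZ : mutually_independent Z).
Variables (p : nat) (g : 'I_p -> 'I_n -> Zs -> R) (K W : R).
Hypotheses (K0 : 0 <= K) (W0 : 0 < W).
Hypothesis momg : forall j, bernstein_moments Z K W (g j).
Variable j0 : 'I_p.
Hypothesis g0 : forall w, centered_sum Z (g j0) w = 0.

(** The default [0] of the maximum is also the value at [j0], whose centered sum vanishes. *)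
Definition max_deviation (w : Om) : R :=
  \big[Num.max/0]_(j < p) (n%:R^-1 * centered_sum Z (g j) w).

Lemma max_deviation_ge0 w : 0 <= max_deviation w.
Proof. exact: bigmax_ge_id. Qed.

Lemma le_max_deviation j w : n%:R^-1 * centered_sum Z (g j) w <= max_deviation w.
Proof. exact: le_bigmax. Qed.

Lemma measurable_max_deviation : measurable_fun [set: Om] max_deviation.
Proof.
apply: measurable_bigmaxr => j; apply: measurable_funM => //.
by apply: measurable_centered_sum; case: (momg j).
Qed.

Let chernoff_sum D w : R :=
  \sum_(j < p) expR (chernoff_rate K W D * (centered_sum Z (g j) w - n%:R * bernstein_bound K W D)).

Let measurable_chernoff_sum D : measurable_fun [set: Om] (chernoff_sum D).
Proof.
apply: measurable_sum => j; apply: measurableT_comp => //; apply: measurable_funM => //.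
by apply: measurable_funB => //; apply: measurable_centered_sum; case: (momg j).
Qed.

(** The rate does not depend on [j], so the left-hand side is one of the summands on the right; the
    default [0] corresponds to the summand of [j0]. *)
Let expR_max_deviation_le D w :
  expR (chernoff_rate K W D * n%:R * (max_deviation w - bernstein_bound K W D)) <= chernoff_sum D w.
Proof.
have nn : (n%:R : R) != 0 by rewrite pnatr_eq0 -lt0n.
have E x : n%:R * (n%:R^-1 * x - bernstein_bound K W D) = x - n%:R * bernstein_bound K W D.
  by rewrite mulrBr mulVKf.
have S j : expR (chernoff_rate K W D * (centered_sum Z (g j) w - n%:R * bernstein_bound K W D))
    <= chernoff_sum D w.
  by rewrite /chernoff_sum (bigD1 j)//= lerDl sumr_ge0// => i _; rewrite expR_ge0.
rewrite -mulrA /max_deviation; elim/big_ind : _ => [|x y Hx Hy|j _].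
- by have := S j0; rewrite g0 -E mulr0.
- by rewrite maxEle; case: ifP.
- by rewrite E.
Qed.

Let integral_chernoff_sum_le D : 0 < D ->
  (\int[Pr]_w (chernoff_sum D w)%:E <= (p%:R * expR (- (n%:R * D / 2)))%:E)%E.
Proof.
move=> D0; rewrite (_ : \int[Pr]_w _ = \int[Pr]_w \sum_(j < p)
  (expR (chernoff_rate K W D * (centered_sum Z (g j) w - n%:R * bernstein_bound K W D)))%:E)%E; last first.
  by apply: eq_integral => w _; rewrite sumEFin.
rewrite ge0_integral_sum//; last first.
- move=> j; apply: measurable_EFin; apply: measurableT_comp => //; apply: measurable_funM => //.
  by apply: measurable_funB => //; apply: measurable_centered_sum; case: (momg j).
apply: (@le_trans _ _ (\sum_(j < p) (expR (- (n%:R * D / 2)))%:E)%E).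
  by apply: lee_sum => j _; exact: chernoff_centered_sum.
by rewrite sumEFin lee_fin sumr_const card_ord -[leLHS]mulr_natl.
Qed.

Lemma max_deviation_tail D : 0 < D ->
  (Pr [set w | (bernstein_bound K W D <= max_deviation w)%R] <=
   (p%:R * expR (- (n%:R * D / 2)))%:E)%E.
Proof.
move=> D0; set A := [set w | _].
have mA : measurable A by apply: measurable_set_ler => //; exact: measurable_max_deviation.
rewrite -[X in Pr X]setIT -integral_indic//.
apply: le_trans (integral_chernoff_sum_le D0); apply: ge0_le_integral => //.
- by apply: measurable_EFin.
- by apply: measurable_EFin.
move=> w _; rewrite lee_fin; apply: le_trans (expR_max_deviation_le D w).
rewrite indicE; case: (boolP (w \in A)) => [/set_mem Aw|_]; last exact: expR_ge0.
rewrite -[leLHS]expR0 ler_expR mulr_ge0 ?subr_ge0//.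
by rewrite mulr_ge0// /chernoff_rate divr_ge0// addr_ge0 ?(ltW W0)// !mulr_ge0.
Qed.

(** The bound [powR_le_expR] is integrated with [h = lam n max_deviation] and [L = lam n H]. For
    [D = Delta n p] the exponential sum has mean at most [1/2], which cancels the slack [2^-1] and
    leaves [H ^ m] with no further constant. *)
Lemma max_deviation_moment m : 2 <= m -> m <= 1 + ln p%:R ->
  (\int[Pr]_w (max_deviation w `^ m)%:E <= (bernstein_bound K W (Delta n p) `^ m)%:E)%E.
Proof.
move=> m2 mp.
set D : R := Delta n p; set H := bernstein_bound K W D.
have p0 : 0 < (p%:R : R) by rewrite ltr0n (leq_ltn_trans _ (ltn_ord j0)).
have n0 : 0 < (n%:R : R) by rewrite ltr0n.
have ln2p : ln (2 * p%:R) = ln 2 + ln p%:R :> R by rewrite lnM ?posrE.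
have ln20 : 0 < ln 2 :> R by rewrite ln_gt0// ltr1n.
have nD : n%:R * D / 2 = ln (2 * p%:R) by rewrite /D /Delta; field; lra.
have D0 : 0 < D.
  by rewrite /D /Delta divr_gt0// mulr_gt0//; lra.
have r0 : 0 < Num.sqrt D by rewrite sqrtr_gt0.
have H0 : 0 < H.
  by rewrite /H /bernstein_bound ltr_pwDl// ?mulr_gt0// mulr_ge0// ltW.
have d0 : 0 < 2 * K * Num.sqrt D + W by rewrite ltr_wpDl// !mulr_ge0// ltW.
set lam := chernoff_rate K W D.
have lam0 : 0 < lam by rewrite /lam /chernoff_rate divr_gt0.
(* This gives [L >= ln (2 p) >= ln p >= m - 1], as [powR_le_expR] requires. *)
have LH : n%:R * D / 2 <= lam * n%:R * H.
  have : D / 2 <= lam * H.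
    rewrite /lam /chernoff_rate [leRHS]mulrAC ler_pdivlMr// /H /bernstein_bound.
    have rD : D = Num.sqrt D ^+ 2 by rewrite sqr_sqrtr// ltW.
    have : 0 <= W * Num.sqrt D ^+ 2 / 2 by rewrite divr_ge0// mulr_ge0 ?sqr_ge0// ltW.
    have -> : Num.sqrt D * (W * Num.sqrt D + K * D) =
      D / 2 * (2 * K * Num.sqrt D + W) + W * Num.sqrt D ^+ 2 / 2.
      by rewrite [in X in K * X]rD [in X in X / 2 * _]rD; field.
    lra.
  by rewrite -(ler_pM2l n0); lra.
set L := lam * n%:R * H in LH.
have mL : m - 1 <= L by lra.
have L0 : 0 < L by lra.
have mL2 : m / L <= 2 by rewrite ler_pdivrMr//; lra.
have mL0 : 0 <= m / L by rewrite divr_ge0//; lra.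
have Hm : 0 <= H `^ m by exact: powR_ge0.
have pt w : max_deviation w `^ m <= H `^ m * (1 - m / L / 2) + H `^ m * (m / L) * chernoff_sum D w.
  have h0 : 0 <= lam * n%:R * max_deviation w.
    by rewrite mulr_ge0 ?max_deviation_ge0// mulr_ge0 ?ltW.
  have := powR_le_expR m2 mL h0.
  rewrite (_ : lam * n%:R * max_deviation w / L = max_deviation w / H); last first.
    by rewrite /L; field; rewrite !gt_eqF.
  rewrite (_ : lam * n%:R * max_deviation w - L = lam * n%:R * (max_deviation w - H)); last first.
    by rewrite /L; ring.
  move=> le1; have := expR_max_deviation_le D w; rewrite -/lam -/H => le2.
  have -> : max_deviation w `^ m = H `^ m * (max_deviation w / H) `^ m.
    by rewrite -powRM ?divr_ge0 ?max_deviation_ge0 ?(ltW H0)// mulrC divfK ?gt_eqF.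
  rewrite -[X in _ + X]mulrA -mulrDr ler_wpM2l// (le_trans le1)//.
  have := ler_wpM2l mL0 le2; lra.
apply: (@le_trans _ _ (\int[Pr]_w ((H `^ m * (1 - m / L / 2))%:E +
    (H `^ m * (m / L))%:E * (chernoff_sum D w)%:E))%E).
  apply: ge0_le_integral => //.
  - by move=> w _; rewrite lee_fin powR_ge0.
  - by apply: measurable_EFin; apply: measurable_fun_powR; exact: measurable_max_deviation.
  - by apply: emeasurable_funD => //; apply: measurable_funeM; exact: measurable_EFin.
  by move=> w _; rewrite -EFinM -EFinD lee_fin.
have cs0 w : 0 <= chernoff_sum D w by rewrite sumr_ge0// => j _; rewrite expR_ge0.
have mcs : measurable_fun [set: Om] (fun w => (chernoff_sum D w)%:E) by exact: measurable_EFin.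
rewrite ge0_integralD//; last 3 first.
- by move=> w _; rewrite lee_fin mulr_ge0//; lra.
- by move=> w _; rewrite -EFinM lee_fin mulr_ge0 // mulr_ge0.
- exact: measurable_funeM.
rewrite integral_cst_probability ge0_integralZl//; last 2 first.
- by move=> w _; rewrite lee_fin.
- by rewrite lee_fin mulr_ge0.
apply: (@le_trans _ _ ((H `^ m * (1 - m / L / 2))%:E + (H `^ m * (m / L))%:E * (2^-1)%:E)%E).
  apply: leeD2l; apply: lee_wpmul2l; first by rewrite lee_fin mulr_ge0.
  apply: le_trans (integral_chernoff_sum_le D0) _.
  rewrite lee_fin nD expRN lnK ?posrE ?mulr_gt0// invfM mulrCA mulfV ?gt_eqF// mulr1//.
by rewrite -EFinM -EFinD lee_fin; lra.
Qed.

End max_deviation.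

(** * Moments of the excess under an averaged power tail *)

Section grid.
Context {R : realType}.
Implicit Types (v K h r : R).

Let grid K h l : R := K * expR (h * l%:R).

(* A layer-cake bound over the geometric grid [K * expR (h * l)]; letting [h] tend
   to [0] recovers the sharp constant of the layer-cake integral. *)
Lemma powR_layer_le v K h r : 0 < K -> 0 < h -> 1 <= r -> 0 <= v ->
  ((Num.max (v - K) 0 `^ r)%:E <=
   \sum_(l <oo) ((K `^ r * (expR (h * r) - 1) * expR (h * r) ^+ l *
      (K * expR (h * l%:R) < v)%R%:R)%:E))%E.
Proof.
move=> K0 h0 r1 v0.
have hr : 0 < h * r by rewrite mulr_gt0//; lra.
have hr0 : 0 <= expR (h * r) - 1 by have := expR_ge1Dx (h * r); lra.
have t0 l : 0 <= K `^ r * (expR (h * r) - 1) * expR (h * r) ^+ l *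
    (K * expR (h * l%:R) < v)%R%:R.
  by rewrite !mulr_ge0 ?powR_ge0// exprn_ge0 ?expR_ge0.
have [vK|Kv] := leP (v - K) 0.
  rewrite powR0; last by rewrite gt_eqF//; lra.
  by apply: nneseries_ge0 => l _ _; rewrite lee_fin.
have Kle : K <= v by lra.
have gridr l : grid K h l `^ r = K `^ r * expR (h * r) ^+ l.
  rewrite /grid powRM ?expR_ge0 ?(ltW K0)// -expRM -expRM_natl; congr (_ * expR _); ring.
(* The coefficients are the increments of the [r]-th power of the grid, so they telescope up to the
   first grid point above [v]; capping at [v] makes the induction uniform in [N]. *)
have H N : Num.min v (grid K h N) `^ r - K `^ r <=
    \sum_(0 <= l < N) K `^ r * (expR (h * r) - 1) * expR (h * r) ^+ l *
      (K * expR (h * l%:R) < v)%R%:R.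
  elim: N => [|N ih].
    by rewrite big_nil /grid mulr0 expR0 mulr1 min_r// subrr.
  rewrite big_nat_recr//=; have [gv|vg] := ltP (grid K h N) v; last first.
    have vg' : v <= grid K h N.+1.
      rewrite (le_trans vg)// /grid ler_pM2l// ler_expR ler_pM2l// ler_nat//.
    move: ih; rewrite !min_l// => /le_trans; apply.
    by rewrite mulr0 addr0.
  rewrite mulr1.
  have : Num.min v (grid K h N.+1) `^ r <= grid K h N.+1 `^ r.
    have g0 : 0 <= grid K h N.+1 by rewrite /grid mulr_ge0 ?expR_ge0// ltW.
    by rewrite ge0_ler_powR ?nnegrE ?le_min ?v0 ?g0 ?ge_min ?lexx ?orbT//; lra.
  move: ih; rewrite min_r ?(ltW gv)// !gridr exprS; lra.
have [N vN] : exists N, v <= grid K h N.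
  exists (Num.truncn (v / (K * h))).+1.
  have := truncnS_gt (v / (K * h)); rewrite ltr_pdivrMr ?mulr_gt0// => lt1.
  rewrite /grid (@le_trans _ _ (K * (h * (Num.truncn (v / (K * h))).+1%:R)))//; first by lra.
  by rewrite ler_pM2l//; have := expR_ge1Dx (h * (Num.truncn (v / (K * h))).+1%:R); lra.
have := H N; rewrite min_l// => {}H.
(* Superadditivity, [(v - K) ^ r + K ^ r <= v ^ r], passes from the excess to the telescoped
   difference. *)
apply: (@le_trans _ _ (v `^ r - K `^ r)%:E).
  rewrite lee_fin; have := powR_addr_ge r1 (ltW Kv) (ltW K0); rewrite subrK; lra.
rewrite -lee_fin in H; apply: le_trans H _; rewrite -sumEFin.
by apply: nneseries_lim_ge => l _ _; rewrite lee_fin.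
Qed.

(** The constant left by the geometric series over a grid of mesh [h]. Its limit as [h] tends to [0]
    is [r / (s - r)], and [expR (h * s)] is an explicit error factor tending to [1]. *)
Lemma expR_ratio_le h r s : 0 < h -> 0 < r -> r < s ->
  (expR (h * r) - 1) / (1 - expR (- (h * (s - r)))) <= r / (s - r) * expR (h * s).
Proof.
move=> h0 r0 rs.
have q0 : 0 < s - r by lra.
have hq : 0 < h * (s - r) by rewrite mulr_gt0.
have d0 : 0 < 1 - expR (- (h * (s - r))).
  by rewrite subr_gt0 expR_lt1 oppr_lt0.
rewrite ler_pdivrMr//.
have E1 : expR (h * r) - 1 <= h * r * expR (h * r).
  have := expR_ge1Dx (- (h * r)); rewrite -(ler_pM2r (expR_gt0 (h * r))) -expRD addNr expR0; lra.
have E2 : h * (s - r) <= expR (h * (s - r)) * (1 - expR (- (h * (s - r)))).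
  by rewrite [leRHS]mulrBr mulr1 -expRD subrr expR0; have := expR_ge1Dx (h * (s - r)); lra.
apply: (le_trans E1).
rewrite (_ : h * s = h * r + h * (s - r)); last by ring.
rewrite expRD -[leRHS]mulrA -[X in _ <= _ * X]mulrA.
apply: (@le_trans _ _ (r / (s - r) * (expR (h * r) * (h * (s - r))))).
  rewrite le_eqVlt; apply/orP; left; apply/eqP; field; lra.
rewrite ler_wpM2l ?divr_ge0 ?(ltW r0) ?(ltW q0)// ler_wpM2l// expR_ge0//.
Qed.

Lemma le_expR_mul_inf (x b s : R) : 0 < b -> 0 < s ->
  (forall h, 0 < h -> x <= b * expR (h * s)) -> x <= b.
Proof.
move=> b0 s0 H; rewrite leNgt; apply/negP => bx.
have x0 : 0 < x by lra.
have lx : 0 < ln (x / b) by rewrite ln_gt0// ltr_pdivlMr// mul1r.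
(* This [h] makes [expR (h * s)] the square root of [x / b > 1], so that [x / b] would be at most
   its own square root. *)
have := H (ln (x / b) / (2 * s)) _; rewrite divr_gt0 ?mulr_gt0// => /(_ erefl).
rewrite (_ : _ / (2 * s) * s = ln (x / b) / 2); last by field; lra.
rewrite -ler_pdivrMl// mulrC => H1.
have : x / b < x / b.
  apply: (le_lt_trans H1); rewrite -[ltRHS]lnK ?posrE ?divr_gt0// ltr_expR; lra.
by rewrite ltxx.
Qed.

End grid.

Section power_tail.
Context d (T : measurableType d) (R : realType) (P : probability T R).
Variables (n : nat) (n_gt0 : (0 < n)%N) (Y : 'I_n -> T -> R).
Hypotheses (mY : forall i, measurable_fun [set: T] (Y i)) (Y0 : forall i w, 0 <= Y i w).

Let mexcess K r i : measurable_fun [set: T] (fun w => (Num.max (Y i w - K) 0) `^ r).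
Proof.
by apply: measurable_fun_powR; apply: measurable_maxr => //; exact: measurable_funB.
Qed.

(** The constant is the integral of [r u ^ (r - 1) (M / u) ^ s] over [u > K]. The tail bound holds
    after summation over [i], so the sums over [i] and over the grid are exchanged first. *)
Lemma excess_moment_le (M s r K : R) : 0 < M -> 1 <= r -> r < s -> 0 < K ->
  (forall L, 0 < L ->
     (\sum_(i < n) P [set w | (L < Y i w)%R] <= (n%:R * (M / L) `^ s)%:E)%E) ->
  (\sum_(i < n) \int[P]_w (Num.max (Y i w - K) 0 `^ r)%:E <=
   (n%:R * (r / (s - r) * M `^ s * K `^ (r - s)))%:E)%E.
Proof.
move=> M0 r1 rs K0 tailY.
set B := n%:R * _.
have n0 : 0 < (n%:R : R) by rewrite ltr0n.
have q0 : 0 < s - r by lra.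
have r0 : 0 < r by lra.
have B0 : 0 < B.
  by rewrite /B mulr_gt0// mulr_gt0 ?powR_gt0// mulr_gt0 ?powR_gt0// divr_gt0.
set X := (\sum_(i < n) _)%E.
have X0 : (0 <= X)%E.
  by apply: sume_ge0 => i _; apply: integral_ge0 => w _; rewrite lee_fin powR_ge0.
suff H h : 0 < h -> (X <= (B * expR (h * s))%:E)%E.
  have Xfin : X \is a fin_num.
    by rewrite ge0_fin_numE// (le_lt_trans (H 1 ltr01))// ltry.
  rewrite -(fineK Xfin) lee_fin; apply: (@le_expR_mul_inf _ _ _ s) => //; first lra.
  by move=> h h0; rewrite -lee_fin fineK//; exact: H.
move=> h0.
have hr : 0 < h * r by rewrite mulr_gt0//; lra.
have hr0 : 0 <= expR (h * r) - 1 by have := expR_ge1Dx (h * r); lra.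
pose c l := K `^ r * (expR (h * r) - 1) * expR (h * r) ^+ l.
have c0 l : 0 <= c l by rewrite !mulr_ge0 ?powR_ge0// exprn_ge0 ?expR_ge0.
pose A i l := [set w | (K * expR (h * l%:R) < Y i w)%R].
have mA i l : measurable (A i l).
  rewrite -[X in measurable X]setTI.
  exact: (measurable_fun_ltr (measurable_cst _) (mY i) measurableT (_ : measurable [set true])).
apply: (@le_trans _ _ (\sum_(i < n) \sum_(l <oo) (c l)%:E * P (A i l))%E).
  apply: lee_sum => i _.
  apply: (@le_trans _ _ (\int[P]_w \sum_(l <oo) ((c l)%:E * (\1_(A i l) w)%:E))%E).
    apply: ge0_le_integral => //.
    - by move=> w _; rewrite lee_fin powR_ge0.
    - exact: measurable_EFin.
    - apply: (@ge0_emeasurable_sum _ _ _ _ _ xpredT) => [l w _ _|l _].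
        by rewrite -EFinM lee_fin mulr_ge0.
      by apply: measurable_funeM; exact: measurable_EFin.
    move=> w _; apply: le_trans (powR_layer_le K0 h0 r1 (Y0 i w)) _.
    apply: lee_nneseries => [l _ _|l _]; first by rewrite lee_fin mulr_ge0// c0.
    rewrite -EFinM lee_fin indicE ler_wpM2l// ?c0//.
    by case: ltP => // lt1; rewrite mem_set.
  rewrite integral_nneseries//.
  - apply: lee_nneseries => [l _ _|l _].
      by apply: integral_ge0 => w _; rewrite -EFinM lee_fin mulr_ge0.
    rewrite ge0_integralZl//; first by rewrite integral_indic// setIT.
      exact: measurable_EFin.
    by rewrite lee_fin.
  - by move=> l; apply: measurable_funeM; exact: measurable_EFin.
  - by move=> l w _; rewrite -EFinM lee_fin mulr_ge0.
rewrite -nneseries_sum; last by move=> i l _; rewrite mule_ge0// lee_fin.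
apply: lime_le.
  by apply: is_cvg_nneseries => l _ _; apply: sume_ge0 => i _; rewrite mule_ge0// lee_fin.
apply: nearW => N.
apply: (@le_trans _ _ (\sum_(0 <= l < N) (n%:R * M `^ s * K `^ (r - s) * (expR (h * r) - 1)
    * expR (- (h * (s - r))) ^+ l)%:E)%E).
  apply: lee_sum => l _; rewrite -ge0_sume_distrr//.
  have Kl : 0 < K * expR (h * l%:R) by rewrite mulr_gt0// expR_gt0.
  apply: (le_trans (lee_wpmul2l _ (tailY _ Kl))); first by rewrite lee_fin.
  rewrite -EFinM lee_fin le_eqVlt; apply/orP; left; apply/eqP.
  have -> : (M / (K * expR (h * l%:R))) `^ s = M `^ s * (K `^ (- s) * expR (- (h * s * l%:R))).
    rewrite powRM ?invr_ge0 ?(ltW M0) ?(ltW Kl)// -[_^-1]powR_inv1 ?(ltW Kl)//.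
    rewrite -powRrM mulN1r powRM ?expR_ge0 ?(ltW K0)//.
    by congr (_ * (_ * _)); rewrite -expRM; congr expR; ring.
  have -> : K `^ (r - s) = K `^ r * K `^ (- s).
    by rewrite -powRD//; apply/implyP => _; rewrite gt_eqF.
  rewrite -!expRM_natl (_ : l%:R * - (h * (s - r)) = l%:R * (h * r) + - (h * s * l%:R)); last by ring.
  by rewrite /c -expRM_natl expRD; ring.
rewrite sumEFin lee_fin -mulr_sumr big_mkord.
have e1 : expR (- (h * (s - r))) < 1 by rewrite expR_lt1 oppr_lt0 mulr_gt0.
have := sum_geometric_le N (expR_ge0 (- (h * (s - r)))) e1.
have := expR_ratio_le h0 r0 rs.
set e := expR (- _); set S := \sum_(_ < _) _; move=> E1 E2.
have a0 : 0 <= n%:R * M `^ s * K `^ (r - s) by rewrite !mulr_ge0 ?powR_ge0.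
rewrite -[leLHS]mulrA (_ : B * _ = n%:R * M `^ s * K `^ (r - s) * (r / (s - r) * expR (h * s))); last first.
  by rewrite /B; ring.
by apply: ler_wpM2l => //; apply: le_trans E1; exact: ler_wpM2l.
Qed.

Lemma powR_integral_le (X : T -> R) (r : R) : 1 <= r ->
  measurable_fun [set: T] X -> (forall w, 0 <= X w) ->
  ((fine (\int[P]_w (X w)%:E)%E `^ r)%:E <= \int[P]_w (X w `^ r)%:E)%E.
Proof.
move=> r1 mX X0; set t := fine _.
have I0 : (0 <= \int[P]_w (X w)%:E)%E by apply: integral_ge0 => w _; rewrite lee_fin.
have J0 : (0 <= \int[P]_w (X w `^ r)%:E)%E.
  by apply: integral_ge0 => w _; rewrite lee_fin powR_ge0.
(* [fine] sends an infinite mean to [0], so this case also disposes of a nonintegrable [X]. *)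
have [->|t0] := eqVneq t 0; first by rewrite powR0//; rewrite gt_eqF//; lra.
have Ifin : (\int[P]_w (X w)%:E)%E \is a fin_num.
  by move: t0; rewrite /t; case: (\int[P]_w _)%E => //=; rewrite eqxx.
have {}t0 : 0 < t by rewrite lt0r t0 fine_ge0.
have r0 : 0 <= r - 1 by lra.
have H : (\int[P]_w ((r * t `^ (r - 1))%:E * (X w)%:E) <=
          \int[P]_w ((X w `^ r)%:E + ((r - 1) * t `^ r)%:E))%E.
  apply: ge0_le_integral => //.
  - by move=> w _; rewrite -EFinM lee_fin mulr_ge0// mulr_ge0 ?powR_ge0//; lra.
  - by apply: measurable_funeM; exact: measurable_EFin.
  - by apply: emeasurable_funD => //; apply: measurable_EFin; exact: measurable_fun_powR.
  move=> w _; rewrite -EFinM -EFinD lee_fin.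
  have := powR_ge_tangent r1 (X0 w) t0; rewrite -(@mulr_powRB1 _ t r) ?(ltW t0)//; lra.
have k0 : 0 <= r * t `^ (r - 1) by rewrite mulr_ge0 ?powR_ge0//; lra.
have E1 : (\int[P]_w ((r * t `^ (r - 1))%:E * (X w)%:E) =
           (r * t `^ (r - 1))%:E * \int[P]_w (X w)%:E)%E.
  by rewrite ge0_integralZl//; do ?[exact: measurable_EFin|by move=> *; rewrite lee_fin|by rewrite lee_fin].
have E2 : (\int[P]_w ((X w `^ r)%:E + ((r - 1) * t `^ r)%:E) =
           \int[P]_w (X w `^ r)%:E + \int[P]_w ((r - 1) * t `^ r)%:E)%E.
  rewrite ge0_integralD//.
  - by move=> w _; rewrite lee_fin powR_ge0.
  - by apply: measurable_EFin; exact: measurable_fun_powR.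
  - by move=> w _; rewrite lee_fin mulr_ge0 ?powR_ge0.
rewrite E1 E2 in H.
rewrite integral_cst_probability -(fineK Ifin) -/t -EFinM in H.
rewrite -leeBlDr// -EFinB in H; apply: le_trans H.
by rewrite lee_fin -(@mulr_powRB1 _ t r) ?(ltW t0)//; lra.
Qed.

Lemma powR_mean_le (x : 'I_n -> R) (r : R) : 1 <= r -> (forall i, 0 <= x i) ->
  (n%:R^-1 * \sum_(i < n) x i) `^ r <= n%:R^-1 * \sum_(i < n) x i `^ r.
Proof.
move=> r1 x0; set c := n%:R^-1 * _.
have n0 : 0 < (n%:R : R) by rewrite ltr0n.
have c0 : 0 <= c by rewrite mulr_ge0 ?invr_ge0// sumr_ge0.
have S0 : 0 <= n%:R^-1 * \sum_(i < n) x i `^ r.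
  by rewrite mulr_ge0 ?invr_ge0// sumr_ge0// => i _; rewrite powR_ge0.
have [->|cn] := eqVneq c 0; first by rewrite powR0// gt_eqF//; lra.
have cp : 0 < c by rewrite lt0r cn.
rewrite -(ler_pM2l n0) mulVKf ?gt_eqF//.
apply: (@le_trans _ _ (\sum_(i < n) (c `^ r + r * c `^ (r - 1) * (x i - c)))).
  rewrite big_split/= -mulr_sumr sumrB !sumr_const !card_ord.
  have -> : \sum_(i < n) x i = c *+ n by rewrite -mulr_natl /c mulVKf ?gt_eqF.
  by rewrite subrr mulr0 addr0 mulr_natl.
by apply: ler_sum => i _; exact: powR_ge_tangent.
Qed.

(** Convexity gives [2 ^ (r - 1)] times the sum of the two [r]-th moments, and Jensen bounds that of
    the mean by that of [X i]; together they make [2 ^ r]. *)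
Lemma excess_mean_moment_le (X : 'I_n -> T -> R) (r b : R) : 1 <= r ->
  (forall i, measurable_fun [set: T] (X i)) -> (forall i w, 0 <= X i w) ->
  (\sum_(i < n) \int[P]_w (X i w `^ r)%:E <= (n%:R * b)%:E)%E ->
  (\int[P]_w ((n%:R^-1 * \sum_(i < n) (X i w + fine (\int[P]_v (X i v)%:E)%E)) `^ r)%:E <=
   (2 `^ r * b)%:E)%E.
Proof.
move=> r1 mX X0 Xb.
have n0 : 0 < (n%:R : R) by rewrite ltr0n.
set t := fun i => fine (\int[P]_v (X i v)%:E)%E.
have t0 i : 0 <= t i by apply: fine_ge0; apply: integral_ge0 => w _; rewrite lee_fin.
have mXr i : measurable_fun [set: T] (fun w => X i w `^ r) by exact: measurable_fun_powR.
(* Midpoint convexity, from two supporting lines at [(x + y) / 2] whose linear parts cancel. *)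
have two x y : 0 <= x -> 0 <= y -> (x + y) `^ r <= 2 `^ r / 2 * (x `^ r + y `^ r).
  move=> x0 y0; have [xy|xy] := eqVneq (x + y) 0.
    rewrite xy powR0; last by rewrite gt_eqF//; lra.
    by rewrite mulr_ge0 ?divr_ge0 ?addr_ge0 ?powR_ge0.
  have c0 : 0 < (x + y) / 2 by rewrite divr_gt0// lt0r xy addr_ge0.
  have := powR_ge_tangent r1 x0 c0; have := powR_ge_tangent r1 y0 c0.
  have e2 : (x + y) `^ r = 2 `^ r * ((x + y) / 2) `^ r.
    by rewrite -powRM ?(ltW c0)// mulrC divfK.
  set k := r * _; have -> : k * (y - (x + y) / 2) = - (k * (x - (x + y) / 2)) by field.
  move=> H1 H2; rewrite e2 -[leRHS]mulrA ler_wpM2l ?powR_ge0//; lra.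
apply: (@le_trans _ _ (\int[P]_w \sum_(i < n) ((2 `^ r / 2 / n%:R)%:E *
    ((X i w `^ r)%:E + (t i `^ r)%:E)))%E).
  apply: ge0_le_integral => //.
  - by move=> w _; rewrite lee_fin powR_ge0.
  - apply: measurable_EFin; apply: measurable_fun_powR; apply: measurable_funM => //.
    by apply: measurable_sum => i; exact: measurable_funD.
  - apply: emeasurable_sum => i; apply: measurable_funeM; apply: emeasurable_funD => //.
    exact: measurable_EFin.
  move=> w _; under [leRHS]eq_bigr do rewrite -EFinD -EFinM.
  rewrite sumEFin lee_fin.
  have xt0 i : 0 <= X i w + t i by rewrite addr_ge0.
  apply: (le_trans (powR_mean_le r1 xt0)).
  rewrite mulr_sumr; apply: ler_sum => i _.
  have := ler_wpM2l (_ : 0 <= n%:R^-1) (two _ _ (X0 i w) (t0 i)).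
  by rewrite invr_ge0 ltW// => /(_ erefl) /le_trans; apply; rewrite mulrA [X in X * _]mulrC.
have w0 : 0 <= 2 `^ r / 2 / n%:R :> R by rewrite !divr_ge0 ?powR_ge0 ?(ltW n0).
rewrite ge0_integral_sum//; last 2 first.
- move=> i; apply: measurable_funeM; apply: emeasurable_funD => //; exact: measurable_EFin.
- by move=> i w _; rewrite -EFinD -EFinM lee_fin mulr_ge0// addr_ge0 ?powR_ge0.
apply: (@le_trans _ _ (\sum_(i < n) ((2 `^ r / n%:R)%:E * \int[P]_w (X i w `^ r)%:E))%E).
  apply: lee_sum => i _; rewrite ge0_integralZl//; last 2 first.
  - by apply: emeasurable_funD => //; exact: measurable_EFin.
  - by move=> w _; rewrite -EFinD lee_fin addr_ge0 ?powR_ge0.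
  rewrite ge0_integralD//; last 3 first.
  - by move=> w _; rewrite lee_fin powR_ge0.
  - exact: measurable_EFin.
  - by move=> w _; rewrite lee_fin powR_ge0.
  rewrite integral_cst_probability.
  apply: (@le_trans _ _ ((2 `^ r / 2 / n%:R)%:E * (\int[P]_w (X i w `^ r)%:E + \int[P]_w (X i w `^ r)%:E)))%E.
    by rewrite lee_wpmul2l// leeD2l// powR_integral_le.
  rewrite -mule2n -mule_natl muleA -EFinM lee_wpmul2r//.
    by apply: integral_ge0 => w _; rewrite lee_fin powR_ge0.
  by rewrite lee_fin (_ : _ * 2 = 2 `^ r / n%:R)//; field; rewrite gt_eqF.
rewrite -ge0_sume_distrr; last by move=> i _; apply: integral_ge0 => w _; rewrite lee_fin powR_ge0.
apply: (le_trans (lee_wpmul2l _ Xb)); first by rewrite lee_fin divr_ge0 ?powR_ge0// ltW.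
rewrite -EFinM lee_fin mulrA divfK ?gt_eqF//.
Qed.

End power_tail.

Section Lnorm_order.
Context d (T : measurableType d) (R : realType) (P : probability T R).
Implicit Types (X Y : T -> R) (b m r : R).

Lemma Lnorm_mono X Y m : 0 < m -> measurable_fun [set: T] X -> measurable_fun [set: T] Y ->
  (forall w, 0 <= X w) -> (forall w, X w <= Y w) ->
  ('N[P]_m%:E[EFin \o X] <= 'N[P]_m%:E[EFin \o Y])%E.
Proof.
move=> m0 mX mY X0 XY.
have Y0 w : 0 <= Y w by exact: le_trans (XY w).
set y := ('N[P]_m%:E[EFin \o Y])%E.
have y0 : (0 <= y)%E by exact: Lnorm_ge0.
have [yoo|] := boolP (y == +oo)%E; first by rewrite (eqP yoo) leey.
move=> yoo; have yfin : y \is a fin_num by rewrite ge0_fin_numE// ltey.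
rewrite -(fineK yfin); apply: Lnorm_le => //; first exact: fine_ge0.
rewrite -poweR_EFin fineK// /y powR_Lnorm ?gt_eqF//.
apply: ge0_le_integral => //.
- by move=> w _; rewrite lee_fin powR_ge0.
- by apply: measurable_EFin; exact: measurable_fun_powR.
- under eq_fun do rewrite /= ger0_norm//.
  by apply: measurable_EFin; exact: measurable_fun_powR.
move=> w _; rewrite /= ger0_norm// lee_fin.
by rewrite ge0_ler_powR ?nnegrE ?(ltW m0).
Qed.

Lemma Lnorm_cst b m : 0 < m -> 0 <= b -> ('N[P]_m%:E[EFin \o cst b] <= b%:E)%E.
Proof. by move=> m0 b0; apply: Lnorm_le => //; rewrite /cst integral_cst_probability. Qed.

Lemma Lnorm_scale_powR_le X a b m r : 0 < m -> 0 <= a -> 0 < b -> 0 < r -> r <= 1 ->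
  measurable_fun [set: T] X -> (forall w, 0 <= X w) ->
  (\int[P]_w (X w `^ m)%:E <= (b `^ m)%:E)%E ->
  ('N[P]_m%:E[EFin \o (fun w => a * X w `^ r)%R] <= (a * b `^ r)%:E)%E.
Proof.
move=> m0 a0 b0 r0 r1 mX X0 H; apply: Lnorm_le => //; rewrite ?mulr_ge0 ?powR_ge0//.
  by move=> w; rewrite mulr_ge0 ?powR_ge0.
under eq_integral do rewrite powRM ?powR_ge0// EFinM.
rewrite ge0_integralZl//; last 3 first.
- by apply: measurable_EFin; do 2 apply: measurable_fun_powR.
- by move=> w _; rewrite lee_fin powR_ge0.
- by rewrite lee_fin powR_ge0.
rewrite powRM ?powR_ge0// EFinM lee_wpmul2l ?lee_fin ?powR_ge0//.
exact: integral_powR_powR_le.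
Qed.

End Lnorm_order.

(** * The oracle inequality in abstract form, common to both cases *)

Section oracle.
Context dO dZ (Om : measurableType dO) (Zs : measurableType dZ) (R : realType).
Variables (Pr : probability Om R) (n : nat) (Z : 'I_n -> {RV Pr >-> Zs}).
Hypotheses (n_gt0 : (0 < n)%N) (indepZ : mutually_independent Z).
Variables (p : nat) (g : 'I_p -> 'I_n -> Zs -> R) (K W : R).
Hypotheses (K0 : 0 <= K) (W0 : 0 < W).
Hypothesis momg : forall j, bernstein_moments Z K W (g j).
Variable j0 : 'I_p.
Hypothesis g0 : forall w, centered_sum Z (g j0) w = 0.
Variables (kappa y : R) (E : 'I_p -> R) (jhat : Om -> 'I_p) (T : Om -> R).
Hypotheses (kappa_ge1 : 1 <= kappa) (y0 : 0 <= y) (E0 : forall j, 0 <= E j).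
Hypotheses (T0 : forall w, 0 <= T w) (mT : measurable_fun [set: Om] T).
Hypothesis mE : measurable_fun [set: Om] (fun w => E (jhat w)).
Hypothesis basic_ineq : forall w, let j := jhat w in
  E j <= y `^ (2 * kappa) +
         (E j `^ (2 * kappa)^-1 + y) * (n%:R^-1 * centered_sum Z (g j) w) + T w.

Let k0 : 0 < 2 * kappa. Proof. by move: kappa_ge1; lra. Qed.

Lemma excess_root_le w :
  E (jhat w) `^ (2 * kappa)^-1 <=
  y + Aconst kappa * max_deviation Z g w `^ (2 * kappa - 1)^-1 + T w `^ (2 * kappa)^-1.
Proof.
apply: root_le_of_powR_le => //; rewrite ?powR_ge0 ?max_deviation_ge0//.
rewrite -powRrM mulVf ?gt_eqF// powRr1//.
apply: (le_trans (basic_ineq w)); rewrite lerD2r lerD2l mulrC ler_wpM2r//.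
  by rewrite addr_ge0 ?powR_ge0.
exact: le_max_deviation.
Qed.

Let mEroot : measurable_fun [set: Om] (fun w => E (jhat w) `^ (2 * kappa)^-1).
Proof. exact: measurable_fun_powR. Qed.

(** Minkowski on the three terms of [excess_root_le]; the moment of the maximum passes through the
    power [1 / (2 kappa - 1) <= 1] by Jensen. *)
Lemma excess_root_Lnorm_le m th : 2 <= m -> m <= 1 + ln p%:R ->
  ('N[Pr]_m%:E[EFin \o (fun w => T w `^ (2 * kappa)^-1)%R] <= th%:E)%E ->
  ('N[Pr]_m%:E[EFin \o (fun w => E (jhat w) `^ (2 * kappa)^-1)%R] <=
   (y + Aconst kappa * bernstein_bound K W (Delta n p) `^ (2 * kappa - 1)^-1 + th)%:E)%E.
Proof.
move=> m2 mp Tth.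
have m0 : 0 < m by lra.
have k1 := kappa_ge1.
have mmax := measurable_max_deviation momg.
pose X w : R := Aconst kappa * max_deviation Z g w `^ (2 * kappa - 1)^-1.
have mX : measurable_fun [set: Om] X.
  by apply: measurable_funM => //; exact: measurable_fun_powR.
have mTr : measurable_fun [set: Om] (fun w => T w `^ (2 * kappa)^-1) by exact: measurable_fun_powR.
have H0 : 0 < bernstein_bound K W (Delta n p).
  have p0 : 1 <= (p%:R : R) by rewrite ler1n (leq_ltn_trans _ (ltn_ord j0)).
  have D0 : 0 < Delta n p :> R.
    by rewrite divr_gt0 ?ltr0n// mulr_gt0// ln_gt0//; lra.
  rewrite /bernstein_bound ltr_pwDl//; first by rewrite mulr_gt0// sqrtr_gt0.
  by rewrite mulr_ge0// ltW.
apply: (@le_trans _ _ ('N[Pr]_m%:E[EFin \o ((cst y \+ X) \+ (fun w => T w `^ (2 * kappa)^-1))%R])%E).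
  apply: Lnorm_mono => //.
  - by do 2 apply: measurable_funD => //.
  - by move=> w; exact: powR_ge0.
  - exact: excess_root_le.
have m1 : (1 <= m%:E)%E by rewrite lee_fin; lra.
apply: le_trans (minkowski_EFin _ _ mTr _) _ => //; first exact: measurable_funD.
rewrite EFinD leeD//.
apply: le_trans (minkowski_EFin _ _ mX _) _ => //.
rewrite EFinD leeD//; first exact: Lnorm_cst.
apply: Lnorm_scale_powR_le => //.
- exact: Aconst_ge0.
- by rewrite invr_gt0; lra.
- by rewrite invf_le1; lra.
- by move=> w; exact: max_deviation_ge0.
- exact: max_deviation_moment.
Qed.

(** With [T = 0] the threshold is reached only if the maximum reaches [bernstein_bound K W D],
    because [Aconst kappa > 0] and the power is strictly increasing. *)
Lemma excess_root_tail D : 0 < D -> (forall w, T w = 0) ->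
  (Pr [set w | (y + Aconst kappa * bernstein_bound K W D `^ (2 * kappa - 1)^-1 <=
                E (jhat w) `^ (2 * kappa)^-1)%R] <=
   (p%:R * expR (- (n%:R * D / 2)))%:E)%E.
Proof.
move=> D0 T00.
apply: le_trans (max_deviation_tail n_gt0 indepZ K0 W0 momg g0 D0).
apply: le_measure; rewrite ?inE.
- by apply: measurable_set_ler.
- apply: measurable_set_ler => //; exact: (measurable_max_deviation momg).
move=> w /= H; have := excess_root_le w; rewrite T00 powR0 ?invr_eq0 ?gt_eqF// addr0.
move=> /(le_trans H); rewrite lerD2l.
have A0 : 0 < Aconst kappa by apply: lt_le_trans (Aconst_ge kappa_ge1); exact: powR_gt0.
have k1 := kappa_ge1.
have q0 : 0 < (2 * kappa - 1)^-1 by rewrite invr_gt0; lra.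
rewrite ler_pM2l//; apply: contraTT; rewrite -!ltNge => lt1.
by rewrite gt0_ltr_powR ?nnegrE ?max_deviation_ge0// (le_trans _ (ltW lt1)) ?max_deviation_ge0.
Qed.

End oracle.

(** * Clipping, centering and the basic inequality *)

Section clip.
Context {R : realType}.
Implicit Types K x : R.

Definition clip K x : R := Num.max (- K) (Num.min K x).

Lemma normr_clip_le K x : 0 <= K -> `|clip K x| <= K.
Proof.
move=> K0; rewrite /clip ler_norml le_max lexx/= ge_max ge_min lexx/= andbT; lra.
Qed.

Lemma normr_clip_le_normr K x : 0 <= K -> `|clip K x| <= `|x|.
Proof.
move=> K0; rewrite /clip; case: (leP K x) => [Kx|xK].
  by rewrite max_r ?ger0_norm//; lra.
case: (leP (- K) x) => // xK'; rewrite normrN (ger0_norm K0) ltr0_norm; lra.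
Qed.

Lemma normr_sub_clip_le K x : 0 <= K -> `|x - clip K x| <= Num.max (`|x| - K) 0.
Proof.
move=> K0; rewrite /clip le_max; case: (leP K x) => [Kx|xK].
  by rewrite max_r; [rewrite ger0_norm ?subr_ge0// ger0_norm ?lexx//; lra|lra].
case: (leP (- K) x) => xK'; first by rewrite subrr normr0 lexx orbT.
by rewrite !ltr0_norm; [apply/orP; left|..]; lra.
Qed.

Lemma measurable_clip d (T : measurableType d) K (h : T -> R) :
  measurable_fun [set: T] h -> measurable_fun [set: T] (fun w => clip K (h w)).
Proof.
move=> mh; apply: measurable_maxr => //.
exact: measurable_minr.
Qed.

End clip.

Section centered_sample.
Context dO dZ (Om : measurableType dO) (Zs : measurableType dZ) (R : realType).
Variables (Pr : probability Om R) (n : nat) (Z : 'I_n -> {RV Pr >-> Zs}).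
Hypothesis n_gt0 : (0 < n)%N.
Implicit Types (g h : Zs -> R) (v : 'I_n -> Zs -> R).

Definition admissible g :=
  measurable_fun [set: Zs] g /\ forall i, (g \o Z i) \in Lfun Pr 1.

(** Oriented as [h] minus [g]: for [g] the empirical minimiser and [h] the reference, its average
    bounds the risk difference from above. *)
Definition deviation g h i z : R := centered Z h i z - centered Z g i z.

Let n0 : 0 < (n%:R : R). Proof. by rewrite ltr0n. Qed.

Lemma admissibleB g h : admissible g -> admissible h -> admissible (g \- h).
Proof.
case=> [mg ig] [mh ih]; split; first exact: measurable_funB.
move=> i; have -> : (g \- h) \o Z i = (g \o Z i) - (h \o Z i) by [].
exact: rpredB.
Qed.

Lemma admissible_integrable g i : admissible g ->
  Pr.-integrable [set: Om] (fun w => (g (Z i w))%:E).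
Proof. by case=> _ /(_ i) /Lfun1_integrable. Qed.

Lemma measurable_centered g i : admissible g -> measurable_fun [set: Zs] (centered Z g i).
Proof. by case=> mg _; exact: measurable_funB. Qed.

Lemma centeredB g h i z : admissible g -> admissible h ->
  centered Z (g \- h) i z = centered Z g i z - centered Z h i z.
Proof.
move=> [_ ig] [_ ih]; rewrite /centered.
have -> : ('E_Pr[(g \- h)%R \o Z i] = 'E_Pr[g \o Z i] - 'E_Pr[h \o Z i])%E.
  by rewrite -expectationB.
rewrite fineB ?expectation_fin_num//=; lra.
Qed.

Lemma riskE g : admissible g -> risk Z g = n%:R^-1 * \sum_(i < n) fine 'E_Pr[g \o Z i].
Proof.
move=> [_ ig]; rewrite /risk /Pmean fineM//; last first.
  by apply/sum_fin_numP => i _ _; exact: expectation_fin_num.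
by congr (_ * _); rewrite -sum_fine// => i _; exact: expectation_fin_num.
Qed.

Lemma riskB g h : admissible g -> admissible h -> risk Z (g \- h) = risk Z g - risk Z h.
Proof.
move=> ag ah; have agh := admissibleB ag ah.
rewrite !riskE// -mulrBr -sumrB; congr (_ * _); apply: eq_bigr => i _.
case: ag ah => [_ ig] [_ ih].
have -> : ('E_Pr[(g \- h)%R \o Z i] = 'E_Pr[g \o Z i] - 'E_Pr[h \o Z i])%E.
  by rewrite -expectationB.
by rewrite fineB ?expectation_fin_num.
Qed.

Lemma abs_moment_leP m v b :
  (abs_moment Z m v <= b%:E)%E <->
  (\sum_(i < n) \int[Pr]_w (`|v i (Z i w)| ^+ m)%:E <= (n%:R * b)%:E)%E.
Proof.
rewrite /abs_moment /Pmean.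
under eq_bigr do rewrite unlock.
by rewrite lee_pdivrMl// -EFinM.
Qed.

Lemma sigma_leP g d : 0 <= d ->
  (sigma Z g <= d%:E)%E <-> (abs_moment Z 2 (centered Z g) <= (d ^+ 2)%:E)%E.
Proof.
move=> d0; rewrite /sigma -[d in X in X <-> _]ger0_norm// -sqrtr_sqr.
by rewrite (_ : (Num.sqrt (d ^+ 2))%:E = sqrte (d ^+ 2)%:E)// lee_sqrt// lee_fin sqr_ge0.
Qed.

Lemma measurable_deviation g h i : admissible g -> admissible h ->
  measurable_fun [set: Zs] (deviation g h i).
Proof. by move=> ag ah; apply: measurable_funB; exact: measurable_centered. Qed.

Lemma integrable_centered g i : admissible g ->
  Pr.-integrable [set: Om] (fun w => (centered Z g i (Z i w))%:E).
Proof.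
move=> ag.
have := integrableB measurableT (admissible_integrable i ag)
  (finite_measure_integrable_cst Pr (fine 'E_Pr[g \o Z i]) measurableT).
by apply.
Qed.

Lemma integral_centered g i : admissible g ->
  (\int[Pr]_w (centered Z g i (Z i w))%:E = 0)%E.
Proof.
move=> ag; rewrite /centered; under eq_integral do rewrite EFinB.
rewrite integralB//; last 2 first.
- exact: admissible_integrable.
- exact: finite_measure_integrable_cst.
rewrite integral_cst_probability fineK; last by case: ag => _ ig; exact: expectation_fin_num.
by rewrite unlock subee//; apply: integrable_fin_num => //; exact: admissible_integrable.
Qed.

Lemma integrable_deviation g h i : admissible g -> admissible h ->
  Pr.-integrable [set: Om] (fun w => (deviation g h i (Z i w))%:E).
Proof.
move=> ag ah; have := integrableB measurableT (integrable_centered i ah) (integrable_centered i ag).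
by apply.
Qed.

Lemma integral_deviation g h i : admissible g -> admissible h ->
  (\int[Pr]_w (deviation g h i (Z i w))%:E = 0)%E.
Proof.
move=> ag ah; rewrite /deviation; under eq_integral do rewrite EFinB.
rewrite integralB//; [|exact: integrable_centered..].
by rewrite !integral_centered// subee.
Qed.

(** The risk difference is the empirical risk difference, which is nonpositive, plus the average
    deviation. *)
Lemma risk_sub_le g h w : admissible g -> admissible h ->
  empirical_risk Z g w <= empirical_risk Z h w ->
  risk Z g <= risk Z h + n%:R^-1 * \sum_(i < n) deviation g h i (Z i w).
Proof.
move=> ag ah; rewrite !riskE// /empirical_risk.
rewrite -!mulrDr !ler_pM2l ?invr_gt0// => emp.
rewrite /deviation /centered !sumrB; lra.
Qed.

(** The triangle inequality for [sigma] through [g0]: losses are compared with the target in the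
    hypotheses, but with the best approximation in the deviations. *)
Lemma deviation_sqr_le g h g0 d1 d2 : admissible g -> admissible h -> admissible g0 ->
  0 <= d1 -> 0 <= d2 ->
  (sigma Z (g \- g0)%R <= d1%:E)%E -> (sigma Z (h \- g0)%R <= d2%:E)%E ->
  (\sum_(i < n) \int[Pr]_w (`|deviation g h i (Z i w)| ^+ 2)%:E <=
   (n%:R * (d1 + d2) ^+ 2)%:E)%E.
Proof.
move=> ag ah ag0 d10 d20 /(sigma_leP _ d10)/abs_moment_leP s1 /(sigma_leP _ d20)/abs_moment_leP s2.
set b := centered Z (g \- g0) in s1; set a := centered Z (h \- g0) in s2.
set S := (\sum_(i < n) _)%E.
have S0 : (0 <= S)%E by apply: sume_ge0 => i _; apply: integral_ge0 => w _; rewrite lee_fin.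
have mb i : measurable_fun [set: Om] (fun w => `|b i (Z i w)| ^+ 2).
  apply: measurable_funX; apply: measurableT_comp => //; apply: measurableT_comp => //.
  by apply: measurable_centered; exact: admissibleB.
have ma i : measurable_fun [set: Om] (fun w => `|a i (Z i w)| ^+ 2).
  apply: measurable_funX; apply: measurableT_comp => //; apply: measurableT_comp => //.
  by apply: measurable_centered; exact: admissibleB.
(* Weighted Cauchy-Schwarz; [e > 0] keeps both weights positive when [d1] or [d2] vanishes. *)
have step e : 0 < e -> (S <= (n%:R * (d1 + d2 + 2 * e) ^+ 2)%:E)%E.
  move=> e0; pose D1 := d1 + e; pose D2 := d2 + e.
  have D10 : 0 < D1 by rewrite /D1; lra.
  have D20 : 0 < D2 by rewrite /D2; lra.
  pose c1 := (D1 + D2) / D1; pose c2 := (D1 + D2) / D2.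
  have c10 : 0 <= c1 by apply: divr_ge0; lra.
  have c20 : 0 <= c2 by apply: divr_ge0; lra.
  apply: (@le_trans _ _ (\sum_(i < n) (c1%:E * \int[Pr]_w (`|b i (Z i w)| ^+ 2)%:E +
      c2%:E * \int[Pr]_w (`|a i (Z i w)| ^+ 2)%:E))%E).
    apply: lee_sum => i _.
    rewrite -!ge0_integralZl//; [|exact: measurable_EFin..].
    rewrite -ge0_integralD//;
      do ?[by apply: measurable_funeM; exact: measurable_EFin|
           by move=> *; rewrite -EFinM lee_fin mulr_ge0].
    apply: ge0_le_integral => //.
    - apply: measurable_EFin; apply: measurable_funX; apply: measurableT_comp => //.
      by apply: measurableT_comp => //; exact: measurable_deviation.
    - by apply: emeasurable_funD; apply: measurable_funeM; exact: measurable_EFin.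
    move=> w _; rewrite -!EFinM -EFinD lee_fin.
    have -> : deviation g h i (Z i w) = a i (Z i w) - b i (Z i w).
      by rewrite /a /b !centeredB// /deviation; ring.
    rewrite !real_normK ?num_real//; move: (a i _) (b i _) => u v.
    have -> : c1 * v ^+ 2 + c2 * u ^+ 2 = (u - v) ^+ 2 + (D2 * v + D1 * u) ^+ 2 / (D1 * D2).
      by rewrite /c1 /c2; field; rewrite !gt_eqF.
    by rewrite lerDl divr_ge0 ?sqr_ge0// mulr_ge0//; lra.
  rewrite big_split/= -!ge0_sume_distrr; last 2 first.
  - by move=> i _; apply: integral_ge0 => w _; rewrite lee_fin.
  - by move=> i _; apply: integral_ge0 => w _; rewrite lee_fin.
  apply: (@le_trans _ _ (c1%:E * (n%:R * d1 ^+ 2)%:E + c2%:E * (n%:R * d2 ^+ 2)%:E)%E).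
    by apply: leeD; rewrite lee_wpmul2l.
  rewrite -!EFinM -EFinD lee_fin.
  have H d D : 0 <= d -> d <= D -> 0 < D -> (D1 + D2) / D * d ^+ 2 <= (D1 + D2) * D.
    move=> d0 dD D0; rewrite mulrAC ler_pdivrMr// -[leRHS]mulrA.
    by apply: ler_wpM2l; [lra|rewrite -expr2 lerXn2r ?nnegrE ?(ltW D0)].
  have H1 : c1 * d1 ^+ 2 <= (D1 + D2) * D1 by apply: H => //; rewrite /D1; lra.
  have H2 : c2 * d2 ^+ 2 <= (D1 + D2) * D2 by apply: H => //; rewrite /D2; lra.
  rewrite (_ : d1 + d2 + 2 * e = D1 + D2); last by rewrite /D1 /D2; ring.
  have := ler_wpM2l (ltW n0) H1; have := ler_wpM2l (ltW n0) H2; lra.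
have Sfin : S \is a fin_num.
  by rewrite ge0_fin_numE// (le_lt_trans (step 1 ltr01))// ltry.
rewrite -(fineK Sfin) lee_fin -ler_pdivrMl//.
have X0 : 0 <= n%:R^-1 * fine S by rewrite mulr_ge0 ?invr_ge0 ?(ltW n0)// fine_ge0.
(* Square roots make the dependence on [e] additive, so that [e] can be sent to [0]. *)
rewrite -[leLHS]sqr_sqrtr// lerXn2r ?nnegrE ?sqrtr_ge0 ?addr_ge0//.
apply/ler_addgt0Pr => e e0.
have e20 : 0 < e / 2 by rewrite divr_gt0.
have := step _ e20; rewrite -(fineK Sfin) lee_fin -ler_pdivrMl//.
rewrite (_ : 2 * (e / 2) = e); last by field.
by rewrite -[X in X <= _ -> _]sqr_sqrtr// ler_pXn2r ?nnegrE ?sqrtr_ge0//; lra.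
Qed.

End centered_sample.

(** * Bernstein's condition for the normalised deviations *)

Section bernstein_deviation.
Context dO dZ (Om : measurableType dO) (Zs : measurableType dZ) (R : realType).
Variables (Pr : probability Om R) (n : nat) (Z : 'I_n -> {RV Pr >-> Zs}).
Hypothesis n_gt0 : (0 < n)%N.
Implicit Types (g h : Zs -> R) (G : 'I_n -> Zs -> R) (K C w y : R).

(** Two of the [k + 2] factors [1 / w] cancel the [w ^ 2] of the variance and leave [C ^ 2]; the
    other [k] are bounded by [1 / y]. Neither constant then depends on [w]. *)
Lemma bernstein_moments_normalize G K C w y : 0 <= K -> 0 < y -> y <= w ->
  (forall i, measurable_fun [set: Zs] (G i)) ->
  (forall i, Pr.-integrable [set: Om] (fun v => (G i (Z i v))%:E)) ->
  (forall k, (\sum_(i < n) \int[Pr]_v (`|G i (Z i v)| ^+ k.+2)%:E <=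
        (n%:R * (k.+2`!%:R / 2 * (2 * K) ^+ k * (C * w) ^+ 2))%:E)%E) ->
  bernstein_moments Z (K / y) C (fun i z => G i z / w).
Proof.
move=> K0 y0 yw mG iG momG.
have w0 : 0 < w by exact: lt_le_trans yw.
split=> [i|i|k].
- exact: measurable_funM.
- have := integrableZr measurableT w^-1 (iG i).
  by apply: eq_integrable => // v _; rewrite EFinM.
have mGk i : measurable_fun [set: Om] (fun v => `|G i (Z i v)| ^+ k.+2).
  by apply: measurable_funX; do 2 apply: measurableT_comp => //.
apply: (@le_trans _ _ (\sum_(i < n) (w ^- k.+2)%:E * \int[Pr]_v (`|G i (Z i v)| ^+ k.+2)%:E)%E).
  apply: lee_sum => i _; rewrite -ge0_integralZl//;
    do ?[exact: measurable_EFin|by rewrite lee_fin invr_ge0 exprn_ge0// ltW].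
  rewrite le_eqVlt; apply/orP; left; apply/eqP; apply: eq_integral => v _.
  by rewrite -EFinM normrM normfV (gtr0_norm w0) exprMn exprVn mulrC.
rewrite -ge0_sume_distrr; last first.
  by move=> i _; apply: integral_ge0 => v _; rewrite lee_fin exprn_ge0.
have wk0 : 0 <= w ^- k.+2 by rewrite invr_ge0 exprn_ge0// ltW.
apply: (le_trans (lee_wpmul2l _ (momG k))); rewrite ?lee_fin//.
have -> : w ^- k.+2 * (n%:R * (k.+2`!%:R / 2 * (2 * K) ^+ k * (C * w) ^+ 2)) =
    n%:R * (k.+2`!%:R / 2 * ((2 * K) / w) ^+ k * C ^+ 2).
  rewrite !exprMn exprVn !exprS; field.
  by rewrite expf_neq0 ?gt_eqF.
rewrite ler_wpM2l// ler_wpM2r ?sqr_ge0// ler_wpM2l ?divr_ge0//.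
rewrite mulrA lerXn2r ?nnegrE ?divr_ge0 ?mulr_ge0 ?(ltW y0) ?(ltW w0)//.
by rewrite ler_wpM2l ?mulr_ge0// lef_pV2 ?posrE.
Qed.

Lemma integrable_dominated (X Y : Om -> R) : measurable_fun [set: Om] X ->
  Pr.-integrable [set: Om] (fun v => (Y v)%:E) -> (forall v, `|X v| <= `|Y v|) ->
  Pr.-integrable [set: Om] (fun v => (X v)%:E).
Proof.
move=> mX iY XY; apply: (le_integrable measurableT _ _ iY); first exact: measurable_EFin.
by move=> v _; rewrite !abse_EFin lee_fin.
Qed.

Lemma bernstein_deviation g h K C w y d : admissible Z g -> admissible Z h ->
  0 <= K -> 0 < y -> y <= w -> 0 <= d -> d <= C * w ->
  (forall k, (abs_moment Z k.+2 (fun i z => (centered Z g i z - centered Z h i z)%R)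
     <= (k.+2`!%:R / 2 * (2 * K) ^+ k * d ^+ 2)%:E)%E) ->
  bernstein_moments Z (K / y) C (fun i z => deviation Z g h i z / w).
Proof.
move=> ag ah K0 y0 yw d0 dw mom; apply: bernstein_moments_normalize => // [i|i|k].
- exact: measurable_deviation.
- exact: integrable_deviation.
have momk := (abs_moment_leP Z n_gt0 _ _ _).1 (mom k).
rewrite (_ : (\sum_(i < n) _ = \sum_(i < n) \int[Pr]_v
    (`|centered Z g i (Z i v) - centered Z h i (Z i v)| ^+ k.+2)%:E)%E); last first.
  by apply: eq_bigr => i _; apply: eq_integral => v _; rewrite /deviation distrC.
apply: (le_trans momk); rewrite lee_fin ler_wpM2l// ler_wpM2l//.
  by rewrite mulr_ge0 ?divr_ge0 ?exprn_ge0 ?mulr_ge0.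
by rewrite lerXn2r ?nnegrE// (le_trans d0).
Qed.

Lemma integrable_clip_deviation g h K i : admissible Z g -> admissible Z h -> 0 <= K ->
  Pr.-integrable [set: Om] (fun v => (clip K (deviation Z g h i (Z i v)))%:E).
Proof.
move=> ag ah K0; apply: integrable_dominated (integrable_deviation i ag ah) _.
  by apply: measurable_clip; apply: measurableT_comp => //; exact: measurable_deviation.
by move=> u; exact: normr_clip_le_normr.
Qed.

(** Of the [k + 2] clipped factors, [k] are bounded by [K] and two by the deviation, so the variance
    yields all moments; the surplus factor [(k + 2)! / 2 * 2 ^ k >= 1] is dropped. *)
Lemma bernstein_clip_deviation g h K C w y : admissible Z g -> admissible Z h ->
  0 < K -> 0 < y -> y <= w ->
  (\sum_(i < n) \int[Pr]_v (`|deviation Z g h i (Z i v)| ^+ 2)%:E <=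
   (n%:R * (C * w) ^+ 2)%:E)%E ->
  bernstein_moments Z (K / y) C (fun i z => clip K (deviation Z g h i z) / w).
Proof.
move=> ag ah K0 y0 yw mom; apply: bernstein_moments_normalize => // [|i|i|k].
- exact: ltW.
- by apply: measurable_clip; exact: measurable_deviation.
- by apply: integrable_clip_deviation => //; exact: ltW.
have mdv i : measurable_fun [set: Om] (fun v => deviation Z g h i (Z i v)).
  by apply: measurableT_comp => //; exact: measurable_deviation.
apply: (@le_trans _ _ (\sum_(i < n) ((K ^+ k)%:E *
    \int[Pr]_v (`|deviation Z g h i (Z i v)| ^+ 2)%:E))%E).
  apply: lee_sum => i _; rewrite -ge0_integralZl//;
    do ?[by apply: measurable_EFin; apply: measurable_funX; exact: measurableT_comp
        |by rewrite lee_fin exprn_ge0// ltW].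
  apply: ge0_le_integral => //.
  - by apply: measurable_EFin; apply: measurable_funX; apply: measurableT_comp => //; exact: measurable_clip.
  - by apply: measurable_funeM; apply: measurable_EFin; apply: measurable_funX; exact: measurableT_comp.
  move=> v _; rewrite -EFinM lee_fin -addn2 exprD ler_pM ?exprn_ge0//.
    by rewrite lerXn2r ?nnegrE ?(ltW K0)// normr_clip_le// ltW.
  by rewrite lerXn2r ?nnegrE// normr_clip_le_normr// ltW.
rewrite -ge0_sume_distrr; last by move=> i _; apply: integral_ge0 => v _; rewrite lee_fin.
apply: (le_trans (lee_wpmul2l _ mom)); first by rewrite lee_fin exprn_ge0// ltW.
rewrite -EFinM lee_fin mulrCA ler_wpM2l// ler_wpM2r ?sqr_ge0// exprMn mulrA.
rewrite -[leLHS]mul1r ler_wpM2r ?exprn_ge0 ?(ltW K0)//.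
apply: mulr_ege1; last by rewrite exprn_ege1// ler1n.
rewrite ler_pdivlMr// mul1r ler_nat factS.
by rewrite (leq_trans (_ : 2 <= k.+2)%N)// leq_pmulr// fact_gt0.
Qed.

Lemma centered_sum_scale G w v : (forall i, Pr.-integrable [set: Om] (fun v => (G i (Z i v))%:E)) ->
  centered_sum Z (fun i z => G i z / w) v = centered_sum Z G v / w.
Proof.
move=> iG; rewrite /centered_sum mulr_suml; apply: eq_bigr => i _; rewrite mulrBl; congr (_ - _).
under eq_integral do rewrite EFinM.
by rewrite integralZr// fineM// integrable_fin_num.
Qed.

Lemma centered_sum_deviation g h v : admissible Z g -> admissible Z h ->
  centered_sum Z (deviation Z g h) v = \sum_(i < n) deviation Z g h i (Z i v).
Proof.
by move=> ag ah; apply: eq_bigr => i _; rewrite integral_deviation// subr0.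
Qed.

Lemma centered_sum_eq0 G v : (forall i z, G i z = 0) -> centered_sum Z G v = 0.
Proof.
move=> G0; rewrite /centered_sum big1// => i _.
by under eq_integral do rewrite G0; rewrite integral0 G0 subrr.
Qed.

(** The deviation has mean zero, so the clipped mean is minus the mean of the removed part.
    Recentering thus costs at most the mean of [X i], on top of the pointwise excess. *)
Lemma deviation_le_clip g h K (X : 'I_n -> Om -> R) v : admissible Z g -> admissible Z h ->
  0 < K ->
  (forall i, Pr.-integrable [set: Om] (fun v => (X i v)%:E)) ->
  (forall i v, Num.max (`|deviation Z g h i (Z i v)| - K) 0 <= X i v) ->
  \sum_(i < n) deviation Z g h i (Z i v) <=
  centered_sum Z (fun i z => clip K (deviation Z g h i z)) v +
  \sum_(i < n) (X i v + fine (\int[Pr]_v (X i v)%:E)%E).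
Proof.
move=> ag ah K0 iX devX; rewrite /centered_sum -big_split/=; apply: ler_sum => i _.
have K0' := ltW K0.
have iclip := integrable_clip_deviation i ag ah K0'.
have clipX u : `|deviation Z g h i (Z i u) - clip K (deviation Z g h i (Z i u))| <= X i u.
  by apply: le_trans (devX i u); exact: normr_sub_clip_le.
have : (\int[Pr]_u (clip K (deviation Z g h i (Z i u)))%:E <= \int[Pr]_u (X i u)%:E)%E.
  rewrite -[leLHS]sube0 -[X in (_ - X)%E](integral_deviation i ag ah).
  rewrite -integralB//; last exact: integrable_deviation.
  apply: le_integral => //; first by apply: integrableB => //; exact: integrable_deviation.
  move=> u _; rewrite -EFinB lee_fin; apply: le_trans (clipX u).
  by rewrite distrC ler_norm.
rewrite -(fineK (integrable_fin_num measurableT iclip)).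
rewrite -(fineK (integrable_fin_num measurableT (iX i))) lee_fin.
by have := clipX v; have := ler_norm (deviation Z g h i (Z i v) - clip K (deviation Z g h i (Z i v))); lra.
Qed.

End bernstein_deviation.

(** * Choice of the clipping level and assembly *)

Lemma powR_expR_ln (R : realType) (x a : R) : 0 < x -> x `^ a = expR (a * ln x).
Proof. by move=> x0; rewrite /powR gt_eqF. Qed.

(* [K] balances the two terms [u K^a] and [v K^(- b)], whose sum it minimises. *)
Lemma optimal_truncation (R : realType) (k s m M D Y : R) :
  1 <= k -> 2 * k <= m -> m < 2 * s * k -> 0 < M -> 0 < D -> 0 < Y ->
  let a := alphac k in let b := betac k s m in
  exists2 K : R, 0 < K &
    Aconst k * (K * D / Y `^ (2 * k)^-1) `^ a +
    (2 `^ (m / (2 * k)) * (m / (2 * k) / (s - m / (2 * k)) * M `^ s *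
       K `^ (m / (2 * k) - s))) `^ m^-1 =
    xi k s m * M `^ (s / m * (a / (a + b))) * D `^ (a * b / (a + b))
      * Y `^ (- ((2 * k)^-1 * (a * b / (a + b)))).
Proof.
move=> k1 km ms M0 D0 Y0 a b.
have m0 : 0 < m by lra.
have A0 : 0 < Aconst k by apply: lt_le_trans (Aconst_ge k1); exact: powR_gt0.
have a0 : 0 < a by rewrite /a /alphac invr_gt0; lra.
have b0 : 0 < b.
  rewrite /b /betac subr_gt0 ltr_pdivlMr// mulrC ltr_pdivrMr; lra.
have q0 : 0 < m / (2 * s * k - m) by rewrite divr_gt0// subr_gt0.
have qE : m / (2 * k) / (s - m / (2 * k)) = m / (2 * s * k - m).
  field; do ?[apply/andP; split]; rewrite gt_eqF//; lra.
rewrite qE; have [q qdef] : exists q, q = m / (2 * s * k - m) by exists (m / (2 * s * k - m)).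
rewrite -qdef; rewrite -qdef in q0.
(* Logarithms of the coefficients [u] and [v]; [lK] below solves the stationarity equation
   [a u K ^ a = b v K ^ (- b)]. *)
pose lu := ln (Aconst k) + a * (ln D - (2 * k)^-1 * ln Y).
pose lv := (2 * k)^-1 * ln 2 + (ln q + s * ln M) / m.
pose lK := (lv - lu + ln (b / a)) / (a + b).
have eK : 0 < expR lK by exact: expR_gt0.
exists (expR lK) => //.
have term1 : Aconst k * (expR lK * D / Y `^ (2 * k)^-1) `^ a = expR (lu + a * lK).
  rewrite -[Aconst k]lnK ?posrE// powR_expR_ln; last first.
    by rewrite divr_gt0 ?powR_gt0// mulr_gt0 ?expR_gt0.
  rewrite lnM ?posrE ?invr_gt0 ?powR_gt0 ?mulr_gt0 ?expR_gt0 ?powR_gt0//.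
  rewrite lnM ?posrE ?expR_gt0// expRK lnV ?posrE ?powR_gt0// ln_powR -expRD.
  by congr expR; rewrite /lu; ring.
have term2 : (2 `^ (m / (2 * k)) * (q * M `^ s *
       expR lK `^ (m / (2 * k) - s))) `^ m^-1 = expR (lv - b * lK).
  rewrite powR_expR_ln; last by rewrite !mulr_gt0 ?powR_gt0 ?expR_gt0.
  rewrite lnM ?posrE ?powR_gt0 ?mulr_gt0 ?expR_gt0 ?powR_gt0//.
  rewrite lnM ?posrE ?powR_gt0 ?mulr_gt0 ?expR_gt0 ?powR_gt0// lnM ?posrE ?powR_gt0//.
  rewrite !ln_powR expRK; congr expR; rewrite /lv /b /betac; field.
  by do ?[apply/andP; split]; rewrite gt_eqF//; lra.
rewrite term1 term2 /xi; cbv zeta.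
rewrite -/a -/b -qdef.
have lnba : ln (a / b) = - ln (b / a) by rewrite -invf_div lnV// posrE divr_gt0.
have ba0 : 0 < b / a by rewrite divr_gt0.
have ab0 : 0 < a / b by rewrite divr_gt0.
rewrite !powR_expR_ln// lnba.
(* The logarithm of the common factor; the two exponentials beside it are the two summands in
   [xi]. *)
pose L := b / (a + b) * ln (Aconst k) + (2 * k)^-1 * (a / (a + b)) * ln 2 +
  a / (a + b) / m * ln q + s / m * (a / (a + b)) * ln M + a * b / (a + b) * ln D +
  - ((2 * k)^-1 * (a * b / (a + b))) * ln Y.
rewrite [RHS](_ : _ = expR L * (expR (a / (a + b) * ln (b / a)) + expR (b / (a + b) * - ln (b / a)))); last first.
  by rewrite /L !expRD; ring.
rewrite mulrDr -!expRD; congr (expR _ + expR _); rewrite /lK /lu /lv /L.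
all: move: (ln _) (ln _) (ln _) (ln _) (ln _) (ln _) => l1 l2 l3 l4 l5 l6.
all: field; do ?[apply/andP; split]; rewrite gt_eqF//; lra.
Qed.

Theorem theorem7p1 (R : realType)
  (dO dZ : measure_display) (Om : measurableType dO) (Zs : measurableType dZ)
  (Pr : probability Om R)
  (n : nat) (n_gt0 : (0 < n)%N)
  (Z : 'I_n -> {RV Pr >-> Zs}) (indepZ : mutually_independent Z)
  (M : metricType R) (F : set M)
  (gamma : M -> Zs -> R)
  (gamma_meas : forall f, F f -> measurable_fun [set: Zs] (gamma f))
  (gamma_int : forall f i, F f -> (gamma f \o Z i) \in Lfun Pr 1)
  (p : nat) (f : 'I_p -> M) (fF : forall j, F (f j))
  (* target *)
  (f0 : M) (f0F : F f0)
  (f0_min : forall g, F g -> risk Z (gamma f0) <= risk Z (gamma g))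
  (* best approximation f_* = f jstar *)
  (jstar : 'I_p)
  (jstar_min : forall j,
     risk Z (gamma (f jstar)) <= risk Z (gamma (f j)))
  (* empirical risk minimizer: gamma_hat = gamma (f (jhat w)) *)
  (jhat : Om -> 'I_p)
  (jhat_min : forall w j,
     empirical_risk Z (gamma (f (jhat w))) w
       <= empirical_risk Z (gamma (f j)) w)
  (Ehat_meas : measurable_fun [set: Om]
     (fun w => risk Z (gamma (f (jhat w)) \- gamma f0)))
  (kappa C : R) (kappa_ge1 : 1 <= kappa) (C_gt0 : 0 < C)
  (margin : forall j,
     mdist (f j) f0 `^ (2 * kappa) / C `^ (2 * kappa)
       <= risk Z (gamma (f j) \- gamma f0))
  (sigma_le_d : forall j,
     (sigma Z (gamma (f j) \- gamma f0)%R <= (mdist (f j) f0)%:E)%E) :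
  let Ehat w := risk Z (gamma (f (jhat w)) \- gamma f0) in
  let Estar := risk Z (gamma (f jstar) \- gamma f0) in
  let D := Delta n p : R in
  let A := Aconst kappa in
  (* (i) *)
  (forall s M0 : R, 1 < s -> 0 < M0 ->
    (forall K : R, 0 < K ->
      (Ptail Z (envelope Z (fun j => gamma (f j)) (gamma (f jstar))) K
         <= ((M0 / K) `^ s)%:E)%E) ->
    forall m tau : R,
      2 * kappa <= m -> m < Num.min (2 * s * kappa) (1 + ln p%:R) -> 0 < tau ->
      let a := alphac kappa in
      let b := betac kappa s m in
      ('N[Pr]_m%:E[EFin \o (fun w => Ehat w `^ (2 * kappa)^-1)%R]
       <= (Num.max Estar tau `^ (2 * kappa)^-1
           + A * C `^ a * D `^ (a / 2)
           + xi kappa s m * M0 `^ (s / m * (a / (a + b)))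
             * D `^ (a * b / (a + b))
             * Num.max Estar tau
                 `^ (- ((2 * kappa)^-1 * (a * b / (a + b)))))%:E)%E)
  /\
  (* (ii) *)
  (forall K : R, 0 < K ->
    (forall (m : nat) (j : 'I_p), (2 <= m)%N ->
      (abs_moment Z m (fun i z => (centered Z (gamma (f j)) i z
                                  - centered Z (gamma (f jstar)) i z)%R)
         <= (m`!%:R / 2 * (2 * K) ^+ (m - 2)
             * mdist (f j) (f jstar) ^+ 2)%:E)%E) ->
    (forall m tau : R,
      2 * kappa <= m -> m < 1 + ln p%:R -> 0 < tau ->
      ('N[Pr]_m%:E[EFin \o (fun w => Ehat w `^ (2 * kappa)^-1)%R]
       <= (Num.max Estar tau `^ (2 * kappa)^-1
           + A * (C * Num.sqrt D
                  + K * D / Num.max Estar tau `^ (2 * kappa)^-1)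
                 `^ (2 * kappa - 1)^-1)%:E)%E)
    /\
    (0 < Estar -> forall t : R, 0 < t ->
      (Pr [set w |
             (Estar `^ (2 * kappa)^-1
             + A * (C * Num.sqrt (D + 2 * t / n%:R)
                    + K * (D + 2 * t / n%:R) / Estar `^ (2 * kappa)^-1)
                   `^ (2 * kappa - 1)^-1
             <= Ehat w `^ (2 * kappa)^-1)%R]
       <= (expR (- t))%:E)%E)).
Proof.
move=> Ehat Estar D A.
have adm h : F h -> admissible Z (gamma h).
  by move=> Fh; split=> [|i]; [exact: gamma_meas|exact: gamma_int].
have admf j := adm _ (fF j).
have n0 : 0 < (n%:R : R) by rewrite ltr0n.
have p1 : 1 <= (p%:R : R) by rewrite ler1n (leq_ltn_trans _ (ltn_ord jstar)).
have ln2p : 0 < ln (2 * p%:R) :> R by rewrite ln_gt0//; lra.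
have D0 : 0 < D by rewrite /D /Delta divr_gt0// mulr_gt0.
have k0 : 0 < 2 * kappa by lra.
have q0 : 0 < 2 * kappa - 1 by lra.
pose E j := risk Z (gamma (f j) \- gamma f0).
pose dv j := deviation Z (gamma (f j)) (gamma (f jstar)).
have EE j : E j = risk Z (gamma (f j)) - risk Z (gamma f0) by apply: riskB => //; exact: adm.
have E0 j : 0 <= E j by rewrite EE subr_ge0; exact: f0_min.
have basic w : E (jhat w) <= Estar + n%:R^-1 * \sum_(i < n) dv (jhat w) i (Z i w).
  rewrite /Estar -/(E jstar) !EE addrAC lerD2r.
  exact: (risk_sub_le n_gt0 (admf _) (admf _) (jhat_min w jstar)).
have dist_le j : mdist (f j) f0 <= C * E j `^ (2 * kappa)^-1.
  have := margin j; rewrite ler_pdivrMr ?powR_gt0// -/(E j) => H.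
  have {H} : mdist (f j) f0 `^ (2 * kappa) <= (C * E j `^ (2 * kappa)^-1) `^ (2 * kappa).
    rewrite powRM ?powR_ge0 ?(ltW C_gt0)// -powRrM mulVf ?gt_eqF// powRr1//.
    by rewrite [leRHS]mulrC.
  apply: contraTT; rewrite -!ltNge => lt1.
  by rewrite gt0_ltr_powR ?nnegrE ?mdist_ge0 ?mulr_ge0 ?powR_ge0 ?(ltW C_gt0).
(* The common weight dominates both distances to the target because [Estar <= Y]. *)
have weight Y : Estar <= Y -> 0 < Y -> forall j,
    [/\ 0 < Y `^ (2 * kappa)^-1,
        Y `^ (2 * kappa)^-1 <= E j `^ (2 * kappa)^-1 + Y `^ (2 * kappa)^-1 &
        mdist (f j) f0 + mdist (f jstar) f0 <=
        C * (E j `^ (2 * kappa)^-1 + Y `^ (2 * kappa)^-1)].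
  move=> EY Y0 j; split; rewrite ?powR_gt0// ?lerDr ?powR_ge0//.
  rewrite mulrDr lerD// (le_trans (dist_le jstar))// ler_pM2l//.
  by rewrite ge0_ler_powR ?nnegrE ?invr_ge0 ?(ltW k0) ?(ltW Y0) ?E0.
have yk Y : 0 < Y -> (Y `^ (2 * kappa)^-1) `^ (2 * kappa) = Y.
  by move=> Y0; rewrite -powRrM mulVf ?gt_eqF// powRr1// ltW.
have dvstar i z : dv jstar i z = 0 by rewrite /dv /deviation subrr.
have cancel c u : 0 < u -> u * (n%:R^-1 * (c / u)) = n%:R^-1 * c :> R.
  by move=> u0; field; rewrite !gt_eqF.
have ln20 : 0 < ln 2 :> R by rewrite ln_gt0//; lra.
split=> [s M0 s1 M00 tailG m tau km mmin tau0|K K0 momK].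
  cbv zeta; set a := alphac kappa; set b := betac kappa s m.
  have [ms mp] : m < 2 * s * kappa /\ m < 1 + ln p%:R by apply/andP; rewrite -lt_min.
  set Y := Num.max Estar tau.
  have Y0 : 0 < Y by rewrite /Y lt_max tau0 orbT.
  have EY : Estar <= Y by rewrite /Y le_max lexx.
  pose y := Y `^ (2 * kappa)^-1.
  have m2 : 2 <= m by lra.
  have m0 : 0 < m by lra.
  pose r := m / (2 * kappa).
  have r1 : 1 <= r by rewrite /r ler_pdivlMr// mul1r.
  have rs : r < s by rewrite /r ltr_pdivrMr//; lra.
  (* The level depends on [Y] but not on the sample, so the clipped functions are deterministic. *)
  have [K K0 KE] := optimal_truncation kappa_ge1 km ms M00 D0 Y0.
  pose env i z := envelope Z (fun j => gamma (f j)) (gamma (f jstar)) i z.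
  have menv i : measurable_fun [set: Zs] (env i).
    apply: measurable_bigmaxr => j; apply: measurableT_comp => //.
    by apply: measurable_funB; exact: measurable_centered.
  have env0 i z : 0 <= env i z by exact: bigmax_ge_id.
  have dv_env j i z : `|dv j i z| <= env i z.
    rewrite /dv /deviation distrC /env /envelope.
    exact: (le_bigmax _ (fun j => `|centered Z (gamma (f j)) i z - centered Z (gamma (f jstar)) i z|)).
  pose X i v := Num.max (env i (Z i v) - K) 0.
  have mX i : measurable_fun [set: Om] (X i).
    apply: measurable_maxr => //; apply: measurable_funB => //.
    exact: measurableT_comp.
  have X0 i v : 0 <= X i v by rewrite /X le_max lexx orbT.
  have tailE L : 0 < L ->
      (\sum_(i < n) Pr [set w | (L < env i (Z i w))%R] <= (n%:R * (M0 / L) `^ s)%:E)%E.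
    by move=> L0; have := tailG L L0; rewrite /Ptail lee_pdivrMl// -EFinM.
  have menvZ i : measurable_fun [set: Om] (fun w => env i (Z i w)) by exact: measurableT_comp.
  have excess u : 1 <= u -> u < s -> (\sum_(i < n) \int[Pr]_w (X i w `^ u)%:E <=
      (n%:R * (u / (s - u) * M0 `^ s * K `^ (u - s)))%:E)%E.
    by move=> u1 us; exact: (excess_moment_le n_gt0 menvZ (fun i w => env0 i _) M00 u1 us K0 tailE).
  (* The excess bound with exponent [1], available because [s > 1]. *)
  have iX i : Pr.-integrable [set: Om] (fun v => (X i v)%:E).
    apply/integrableP; split; first exact: measurable_EFin.
    under eq_integral do rewrite gee0_abs ?lee_fin// -[X i _]powRr1//.
    apply: le_lt_trans (le_lt_trans (excess 1 (lexx _) s1) (ltry _)).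
    rewrite (bigD1 i)//= leeDl// sume_ge0// => l _.
    by apply: integral_ge0 => w _; rewrite lee_fin powR_ge0.
  pose T w := n%:R^-1 * \sum_(i < n) (X i w + fine (\int[Pr]_v (X i v)%:E)%E).
  have T0 w : 0 <= T w.
    rewrite mulr_ge0 ?invr_ge0// sumr_ge0// => i _.
    by rewrite addr_ge0// fine_ge0// integral_ge0// => v _; rewrite lee_fin.
  have mT : measurable_fun [set: Om] T.
    apply: measurable_funM => //; apply: measurable_sum => i; exact: measurable_funD.
  pose g j i z := clip K (dv j i z) / (E j `^ (2 * kappa)^-1 + y).
  have momg j : bernstein_moments Z (K / y) C (g j).
    have [y0 yw dw] := weight Y EY Y0 j.
    apply: bernstein_clip_deviation => //.
    apply: le_trans (deviation_sqr_le n_gt0 (admf j) (admf jstar) (adm _ f0F)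
      (mdist_ge0 _ _) (mdist_ge0 _ _) (sigma_le_d j) (sigma_le_d jstar)) _.
    rewrite lee_fin ler_pM2l// lerXn2r ?nnegrE ?addr_ge0 ?mdist_ge0//.
    by rewrite (le_trans _ dw)// addr_ge0 ?mdist_ge0.
  have y0 : 0 < y by exact: powR_gt0.
  have g0 w : centered_sum Z (g jstar) w = 0.
    apply: centered_sum_eq0 => i z; rewrite /g dvstar /clip minC.
    by rewrite min_l ?(ltW K0)// max_r ?mul0r// oppr_le0 ltW.
  have ineq w : let j := jhat w in E j <= y `^ (2 * kappa) +
      (E j `^ (2 * kappa)^-1 + y) * (n%:R^-1 * centered_sum Z (g j) w) + T w.
    move=> j; rewrite yk//; apply: (le_trans (basic w)); rewrite -addrA lerD//.
    rewrite centered_sum_scale; last first.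
      by move=> i; apply: integrable_clip_deviation => //; exact: ltW.
    have w0 : 0 < E j `^ (2 * kappa)^-1 + y by rewrite ltr_wpDl ?powR_ge0.
    rewrite cancel// -mulrDr ler_pM2l ?invr_gt0//.
    apply: deviation_le_clip => // i v.
    by rewrite /X ge_max !le_max lexx orbT andbT lerD2r dv_env.
  pose th := (2 `^ r * (r / (s - r) * M0 `^ s * K `^ (r - s))) `^ m^-1.
  have Tth : ('N[Pr]_m%:E[EFin \o (fun w => T w `^ (2 * kappa)^-1)%R] <= th%:E)%E.
    apply: Lnorm_le => //; [exact: powR_ge0|by move=> w; exact: powR_ge0|].
    rewrite -powRrM mulVf ?gt_eqF// powRr1; last first.
      rewrite mulr_ge0 ?powR_ge0// mulr_ge0 ?powR_ge0// mulr_ge0 ?powR_ge0//.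
      by rewrite divr_ge0 ?subr_ge0 ?(ltW rs)//; lra.
    under eq_integral do rewrite -powRrM [_^-1 * m]mulrC -/r.
    exact: (excess_mean_moment_le n_gt0 r1 mX X0 (excess r r1 rs)).
  have := excess_root_Lnorm_le n_gt0 indepZ (ltW (divr_gt0 K0 y0)) C_gt0 momg g0
    kappa_ge1 (ltW y0) E0 T0 mT Ehat_meas ineq m2 (ltW mp) Tth.
  move=> /le_trans; apply; rewrite lee_fin -/y -[leLHS]addrA -[leRHS]addrA lerD2l.
  rewrite -KE -/r -/th [leRHS]addrA lerD2r.
  rewrite -mulrA -mulrDr ler_wpM2l ?Aconst_ge0// /bernstein_bound.
  rewrite (_ : a = (2 * kappa - 1)^-1)//.
  have -> : D `^ ((2 * kappa - 1)^-1 / 2) = Num.sqrt D `^ (2 * kappa - 1)^-1.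
    by rewrite mulrC powRrM powR12_sqrt// ltW.
  rewrite -powRM ?(ltW C_gt0) ?sqrtr_ge0// mulrAC.
  (* Subadditivity of the power [a <= 1] separates [C sqrt D] from the term in [K] that was balanced
     against [th]. *)
  apply: powR_add_le.
  - by rewrite invr_gt0.
  - by rewrite invf_le1//; lra.
  - by rewrite mulr_ge0 ?sqrtr_ge0 ?(ltW C_gt0).
  - by rewrite divr_ge0 ?(ltW y0)// mulr_ge0 ?(ltW K0) ?(ltW D0).
(* [Y] stays general: it is [Num.max Estar tau] for the norm bound and [Estar] for the tail
   bound. *)
have core Y : Estar <= Y -> 0 < Y -> let y := Y `^ (2 * kappa)^-1 in
    let g j i z := dv j i z / (E j `^ (2 * kappa)^-1 + y) in
    [/\ 0 < y, forall j, bernstein_moments Z (K / y) C (g j),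
        forall w, centered_sum Z (g jstar) w = 0 &
        forall w, let j := jhat w in E j <= y `^ (2 * kappa) +
          (E j `^ (2 * kappa)^-1 + y) * (n%:R^-1 * centered_sum Z (g j) w) + 0].
  move=> EY Y0 y g; have y0 : 0 < y by exact: powR_gt0.
  split=> // [j|w|w].
  - have [_ yw dw] := weight Y EY Y0 j.
    apply: (@bernstein_deviation _ _ _ _ _ _ _ _ n_gt0 _ _ _ _ _ _ (mdist (f j) (f jstar))) => //.
    + exact: ltW.
    + exact: mdist_ge0.
    (* The moment condition now involves the distance to [f jstar], so the triangle inequality of
       the metric replaces that of [sigma]. *)
    + apply: le_trans dw; rewrite (metric_sym (f jstar)); exact: metric_triangle.
    by move=> k; have := momK k.+2 j isT; rewrite subSS subSS subn0.
  - by apply: centered_sum_eq0 => i z; rewrite /g dvstar mul0r.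
  cbv zeta; set j := jhat w.
  rewrite yk// addr0; apply: (le_trans (basic w)); rewrite lerD//.
  have w0 : 0 < E j `^ (2 * kappa)^-1 + y by rewrite ltr_wpDl ?powR_ge0.
  rewrite centered_sum_scale; last by move=> i; exact: integrable_deviation.
  by rewrite centered_sum_deviation// cancel.
pose T (w : Om) : R := 0.
have T0 w : 0 <= T w by exact: lexx.
have mT : measurable_fun [set: Om] T by exact: measurable_cst.
split=> [m tau km mp tau0|Es0 t t0].
  set Y := Num.max Estar tau.
  have Y0 : 0 < Y by rewrite /Y lt_max tau0 orbT.
  have EY : Estar <= Y by rewrite /Y le_max lexx.
  have [y0 momg g0 ineq] := core Y EY Y0.
  have m2 : 2 <= m by lra.
  have Tth : ('N[Pr]_m%:E[EFin \o (fun w => T w `^ (2 * kappa)^-1)%R] <= 0%:E)%E.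
    apply: le_trans (@Lnorm_cst _ _ _ Pr 0 m _ _) => //; last by lra.
    by rewrite /T powR0 ?invr_eq0 ?gt_eqF.
  have := excess_root_Lnorm_le n_gt0 indepZ (ltW (divr_gt0 K0 y0)) C_gt0 momg g0
    kappa_ge1 (ltW y0) E0 T0 mT Ehat_meas ineq m2 (ltW mp) Tth.
  by rewrite addr0 /bernstein_bound [K / _ * _]mulrAC.
have [y0 momg g0 ineq] := core Estar (lexx _) Es0.
have D'0 : 0 < D + 2 * t / n%:R by rewrite addr_gt0// divr_gt0// mulr_gt0.
have := excess_root_tail n_gt0 indepZ (ltW (divr_gt0 K0 y0)) C_gt0 momg g0
    kappa_ge1 (ltW y0) E0 T0 Ehat_meas ineq D'0 (fun=> erefl _).
rewrite /bernstein_bound [K / _ * _]mulrAC => /le_trans; apply.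
(* The shift by [2 t / n] turns the exponent into [ln (2 p) + t], so the [p] terms add up to
   [expR (- t) / 2]. *)
rewrite lee_fin (_ : n%:R * (D + 2 * t / n%:R) / 2 = ln (2 * p%:R) + t); last first.
  by rewrite /D /Delta; field; rewrite gt_eqF.
rewrite opprD expRD (expRN (ln _)) lnK ?posrE ?mulr_gt0//; last lra.
rewrite mulrA -[leRHS]mul1r ler_wpM2r ?expR_ge0// ler_pdivrMr; lra.
Qed.
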